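(* Let $X$ be a real locally convex space and $\mu$ a probability measure on the Borel sets of $X$ such that every continuous linear functional on $X$ is $\mu$-integrable and has $\mu$-integral zero. Let $\mathcal{L}(\mu)$, the asymmetric norms $p,\bar p$ on $\mathcal{L}(\mu)$, the function $W_\mu:\mathcal{L}(\mu)\to\overline{\mathbb{R}}$, its convex conjugate $W_\mu^*:(\mathcal{L}(\mu),\bar p)^*\to\overline{\mathbb{R}}$ and the dual norm $\Vert\cdot\Vert_s^*$ be as defined in the context. Let $y\in\mathrm{dom}\,W_\mu^*$ be such that for some $\epsilon>0$, $$\sup\left\{W_\mu^*(y+z)\ \middle|\ z\in(\mathcal{L}(\mu),\bar p)^*:\ \Vert z\Vert_s^*<\epsilon\right\}<\infty.$$ Then there is a $T\in\mathcal{L}(\mu)$ such that the infimum of $W_\mu-y$ over $\mathcal{L}(\mu)$ is attained at $T$, every minimising sequence of $W_\mu-y$ in $\mathcal{L}(\mu)$ converges $\bar p$-weakly to $T$, and $W_\mu^*$ is right Gâteaux differentiable at $y$ with derivative equal to $T$, i.e. $DW_\mu^*(y)$ is the evaluation map $z\mapsto z(T)$ on $(\mathcal{L}(\mu),\bar p)^*$.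
   Context: $\overline{\mathbb{R}}=\{-\infty\}\cup\mathbb{R}\cup\{\infty\}$; $\mathrm{dom}\,F=\{u:F(u)<\infty\}$; $\mathrm{epi}\,F=\{(u,t):t\in\mathbb{R},\,F(u)\le t\}$. Let $X^*$ be the space of continuous linear functionals on the locally convex space $X$ and $[\cdot]_\mu$ the equivalence class modulo $\mu$-almost everywhere equality. Put $\mathcal{K}(\mu)=\{[\phi]_\mu:\phi\in X^*\}$, and let $\mathcal{M}(\mu)$ be its completion in the topology of convergence in $\mu$-measure, i.e. its closure in the space $L^0(\mu)$ of classes of real measurable functions with that topology. The cumulant-generating function $V_\mu:\mathcal{K}(\mu)\to\overline{\mathbb{R}}$ is $V_\mu(T)=\ln\int_X\exp[T]\,\mathrm{d}\mu$. Let $\overline{W}_\mu:\mathcal{M}(\mu)\to\overline{\mathbb{R}}$ be the greatest lower semicontinuous function (for convergence in $\mu$-measure) whose restriction to $\mathcal{K}(\mu)$ is $\le V_\mu$; equivalently, $\mathrm{epi}\,\overline{W}_\mu$ is the closure of $\mathrm{epi}\,V_\mu$ in $\mathcal{M}(\mu)\times\mathbb{R}$. Put $\mathcal{L}(\mu)=\mathcal{M}(\mu)\cap L^1(\mu)$ and let $W_\mu$ be the restriction of $\overline{W}_\mu$ to $\mathcal{L}(\mu)$. Equip $\mathcal{L}(\mu)$ with the asymmetric norm $p(T)=\int_X\max\{-T,0\}\,\mathrm{d}\mu$, and put $\bar p(T)=p(-T)=\int_X\max\{T,0\}\,\mathrm{d}\mu$. The dual cone $Y:=(\mathcal{L}(\mu),\bar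 p)^*$ is the set of linear functionals $z:\mathcal{L}(\mu)\to\mathbb{R}$ for which there is $C\ge0$ with $z(T)\le C\,\bar p(T)$ for all $T\in\mathcal{L}(\mu)$. It is closed under sums and non-negative multiples and carries $\Vert z\Vert_Y=\sup\{z(T):\bar p(T)<1\}$; its topology has at $u\in Y$ the neighbourhood basis $\{u+z:z\in Y,\Vert z\Vert_Y<r\}$, $r>0$. $\mathcal{L}(\mu)_s$ denotes $\mathcal{L}(\mu)$ with the norm $\max\{p,\bar p\}$, and $\Vert\cdot\Vert_s^*$ is the dual norm on the topological dual $(\mathcal{L}(\mu)_s)^*$, which contains $Y$. The convex conjugate is $W_\mu^*(y)=\sup_{T\in\mathcal{L}(\mu)}[y(T)-W_\mu(T)]$ for $y\in Y$. A minimising sequence of $W_\mu-y$ is a sequence $(T_n)$ in $\mathcal{L}(\mu)$ with $\lim_n(W_\mu(T_n)-y(T_n))=\inf_{\mathcal{L}(\mu)}(W_\mu-y)$. A sequence $(T_n)$ converges $\bar p$-weakly to $T$ if $\limsup_{n\to\infty}z(T_n-T)\le0$ for all $z\in Y$. A function $F:Y\to\overline{\mathbb{R}}$ is right Gâteaux differentiable at $u\in Y$ if $F(u)\in\mathbb{R}$ and there is a continuous map $L:Y\to\mathbb{R}$, linear with respect to linear combinations with non-negative scalars, such that $\lim_{t\searrow0}\frac1t[F(u+tv)-F(u)-tL(v)]=0$ for all $v\in Y$; then $DF(u):=L$. *)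

(* Defs.v *)
From HB Require Import structures.
From mathcomp Require Import all_boot all_order all_algebra.
From mathcomp Require Import all_classical all_reals all_analysis.
From mathcomp Require Import measurable_realfun.

Set Implicit Arguments.
Unset Strict Implicit.
Unset Printing Implicit Defensive.

Import Order.TTheory GRing.Theory Num.Theory.
Import numFieldNormedType.Exports.

Local Open Scope classical_set_scope.
Local Open Scope ring_scope.

(* The space L^0(mu) of classes of real measurable functions modulo mu-almost
   everywhere equality. A class is coerced to a function by choosing a
   representative. *)
Definition L0 {d} {T : measurableType d} {R : realType}
  (mu : {measure set T -> \bar R}) : Type := {mfun_ mu, T >-> R}.

Section L0_theory.
Local Open Scope quotient_scope.
Context {d} {T : measurableType d} {R : realType}.
Variable mu : {measure set T -> \bar R}.
Local Notation L0 := (L0 mu).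

HB.instance Definition _ := Choice.on L0.

Definition cls (f : T -> R) (mf : measurable_fun setT f) : L0 :=
  \pi_({mfun_ mu, T >-> R}) (mfun_Sub (mem_set mf)).

Definition L0_fun (u : L0) : T -> R := aqEqMfun_to_fun u.
Coercion L0_fun : L0 >-> Funclass.

Lemma L0_measurable (u : L0) : measurable_fun setT u.
Proof. by rewrite /L0_fun /aqEqMfun_to_fun. Qed.

Lemma clsE (f : T -> R) (mf : measurable_fun setT f) :
  cls mf = f %[ae mu].
Proof.
have /ae_eqP : cls mf == cls mf %[mod {mfun_ mu, T >-> R}] by [].
rewrite /cls; set g := mfun_Sub _.
have : repr (\pi_({mfun_ mu, T >-> R}) g) == g %[mod {mfun_ mu, T >-> R}].
  by rewrite reprK.
by rewrite eqmodE => /asboolP.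
Qed.

Lemma L0_eqP (u v : L0) : u = v <-> u = v %[ae mu].
Proof.
split=> [->|uv]; first exact: ae_eq_refl.
rewrite -[u]reprK -[v]reprK; apply/eqP; rewrite eqmodE; exact/asboolP.
Qed.

Definition L0_zero : L0 := cls (measurable_cst (0 : R)).
Definition L0_opp (u : L0) : L0 := cls (measurable_funN (L0_measurable u)).
Definition L0_add (u v : L0) : L0 :=
  cls (measurable_funD (L0_measurable u) (L0_measurable v)).
Definition L0_scale (a : R) (u : L0) : L0 :=
  cls (measurable_funM (measurable_cst a) (L0_measurable u)).


Lemma L0_zeroE : L0_zero = cst 0 %[ae mu]. Proof. exact: clsE. Qed.
Lemma L0_oppE u : L0_opp u = \- u %[ae mu]. Proof. exact: clsE. Qed.
Lemma L0_addE u v : L0_add u v = u \+ v %[ae mu]. Proof. exact: clsE. Qed.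
Lemma L0_scaleE a u : L0_scale a u = a \*o u %[ae mu].
Proof. exact: clsE. Qed.

Let addA : associative L0_add.
Proof.
move=> u v w; apply/L0_eqP.
near=> x => xT.
have -> // := near (L0_addE u (L0_add v w)) x.
have -> // := near (L0_addE (L0_add u v) w) x.
rewrite /=.
have -> // := near (L0_addE u v) x.
have -> // := near (L0_addE v w) x.
by rewrite /= addrA.
Unshelve. all: by end_near. Qed.

Let addC : commutative L0_add.
Proof.
move=> u v; apply/L0_eqP; near=> x => xT.
have -> // := near (L0_addE u v) x.
have -> // := near (L0_addE v u) x.
by rewrite /= addrC.
Unshelve. all: by end_near. Qed.

Let add0 : left_id L0_zero L0_add.
Proof.
move=> u; apply/L0_eqP; near=> x => xT.
have -> // := near (L0_addE L0_zero u) x.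
rewrite /=.
have -> // := near L0_zeroE x.
by rewrite /= add0r.
Unshelve. all: by end_near. Qed.

Let addN : left_inverse L0_zero L0_opp L0_add.
Proof.
move=> u; apply/L0_eqP; near=> x => xT.
have -> // := near (L0_addE (L0_opp u) u) x.
rewrite /=.
have -> // := near L0_zeroE x.
have -> // := near (L0_oppE u) x.
by rewrite /= addNr.
Unshelve. all: by end_near. Qed.

HB.instance Definition _ := GRing.isZmodule.Build L0 addA addC add0 addN.

Let scaleA a b u : L0_scale a (L0_scale b u) = L0_scale (a * b) u.
Proof.
apply/L0_eqP; near=> x => xT.
have -> // := near (L0_scaleE a (L0_scale b u)) x.
have -> // := near (L0_scaleE (a * b) u) x.
rewrite /=.
have -> // := near (L0_scaleE b u) x.
by rewrite /= mulrA.
Unshelve. all: by end_near. Qed.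

Let scale1 : left_id 1 L0_scale.
Proof.
move=> u; apply/L0_eqP; near=> x => xT.
have -> // := near (L0_scaleE 1 u) x.
by rewrite /= mul1r.
Unshelve. all: by end_near. Qed.

Let scaleDr : right_distributive L0_scale +%R.
Proof.
move=> a u v; apply/L0_eqP; near=> x => xT.
have -> // := near (L0_scaleE a (u + v)) x.
have -> // := near (L0_addE (L0_scale a u) (L0_scale a v)) x.
rewrite /=.
have -> // := near (L0_addE u v) x.
rewrite /=.
have -> // := near (L0_scaleE a u) x.
have -> // := near (L0_scaleE a v) x.
by rewrite /= mulrDr.
Unshelve. all: by end_near. Qed.

Let scaleDl u : {morph L0_scale^~ u : a b / a + b}.
Proof.
move=> a b; apply/L0_eqP; near=> x => xT.
have -> // := near (L0_scaleE (a + b) u) x.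
have -> // := near (L0_addE (L0_scale a u) (L0_scale b u)) x.
rewrite /=.
have -> // := near (L0_scaleE a u) x.
have -> // := near (L0_scaleE b u) x.
by rewrite /= mulrDl.
Unshelve. all: by end_near. Qed.

HB.instance Definition _ :=
  GRing.Zmodule_isLmodule.Build R L0 scaleA scale1 scaleDr scaleDl.

Lemma L0D (u v : L0) : (u + v : L0) = u \+ v %[ae mu].
Proof. exact: L0_addE. Qed.
Lemma L0N (u : L0) : (- u : L0) = \- u %[ae mu]. Proof. exact: L0_oppE. Qed.
Lemma L0Z a (u : L0) : (a *: u : L0) = a \*o u %[ae mu].
Proof. exact: L0_scaleE. Qed.
Lemma L00 : (0 : L0) = cst 0 %[ae mu]. Proof. exact: L0_zeroE. Qed.

(* These balls define the topology of convergence in mu-measure. *)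
Definition L0_ball (u : L0) (e : R) (v : L0) : Prop :=
  (mu [set x | e <= `|u x - v x|]%R < e%:E)%E.

Let measurable_gap (u v : L0) (e : R) :
  measurable [set x | e <= `|u x - v x|]%R.
Proof.
rewrite -[X in measurable X]setTI.
have mf : measurable_fun setT (fun x => `|u x - v x|).
  apply: measurableT_comp => //.
  by apply: measurable_funB; exact: L0_measurable.
have -> : [set x | e <= `|u x - v x|]%R = (fun x => `|u x - v x|) @^-1` `[e, +oo[.
  by apply/seteqP; split=> x /=; rewrite in_itv/= andbT.
exact: mf.
Qed.

Let ball_center u (e : R) : 0 < e -> L0_ball u e u.
Proof.
move=> e0; rewrite /L0_ball (_ : [set _ | _] = set0) ?measure0 ?lte_fin//.
by apply/seteqP; split=> x //=; rewrite subrr normr0 leNgt e0.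
Qed.

Let ball_sym u v (e : R) : L0_ball u e v -> L0_ball v e u.
Proof.
by rewrite /L0_ball; under eq_set => x do rewrite distrC.
Qed.

Let ball_triangle u v w (e1 e2 : R) :
  L0_ball u e1 v -> L0_ball v e2 w -> L0_ball u (e1 + e2) w.
Proof.
rewrite /L0_ball => uv vw; rewrite EFinD.
apply: le_lt_trans (lteD uv vw).
apply: le_trans (measureU2 _ (measurable_gap _ _ _) (measurable_gap _ _ _)).
apply: le_measure; rewrite ?inE//; first exact: measurableU.
move=> x /= e12.
have [|ux] := leP e1 `|u x - v x|; first by left.
have [|vx] := leP e2 `|v x - w x|; first by right.
by move: e12; rewrite leNgt (le_lt_trans (ler_distD (v x) _ _))// ltrD.
Qed.

HB.instance Definition _ :=
  hasNbhs.Build L0 (nbhs_ (entourage_ L0_ball)).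
HB.instance Definition _ := @Nbhs_isPseudoMetric.Build R L0
  (entourage_ L0_ball) erefl L0_ball ball_center ball_sym ball_triangle erefl.

Let ae_le_measure (A B : set T) : measurable A -> measurable B ->
  (\forall x \ae mu, A x -> B x) -> (mu A <= mu B)%E.
Proof.
move=> mA mB [N [mN N0 AB]].
apply: (@le_trans _ _ (mu (B `|` N))).
  apply: le_measure; rewrite ?inE//; first exact: measurableU.
  move=> x Ax; have [|/contrapT nN] := pselect (~ N x); last by right.
  by move=> /(contra_not (@AB x)) /contrapT /(_ Ax); left.
apply: le_trans (measureU2 _ mB mN) _.
have NN : mu N = 0%E by exact: N0.
by rewrite [X in (_ + X)%E]NN adde0.
Qed.

Lemma L0_ballD (u v u' v' : L0) (e : R) :
  L0_ball u (e / 2) u' -> L0_ball v (e / 2) v' -> L0_ball (u + v) e (u' + v').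
Proof.
move=> uu vv; rewrite /L0_ball [ltRHS](_ : _ = (e / 2)%:E + (e / 2)%:E)%E; last first.
  by rewrite -EFinD -splitr.
apply: le_lt_trans (lteD uu vv).
apply: le_trans (measureU2 _ (measurable_gap _ _ _) (measurable_gap _ _ _)).
apply: ae_le_measure => //; first exact: measurableU.
near=> x => /=.
have -> // := near (L0D u v) x.
have -> // := near (L0D u' v') x.
rewrite /= => h.
have [|ux] := leP (e / 2) `|u x - u' x|; first by left.
have [|vx] := leP (e / 2) `|v x - v' x|; first by right.
move: h; rewrite leNgt opprD addrACA (le_lt_trans (ler_normD _ _))//.
by rewrite [ltRHS]splitr ltrD.
Unshelve. all: by end_near. Qed.

Lemma L0_ballZ (a : R) (u u' : L0) (e : R) : 0 < e ->
  L0_ball u (e / (1 + `|a|)) u' -> L0_ball (a *: u) e (a *: u').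
Proof.
move=> e0 uu; have a0 : 0 < 1 + `|a| by rewrite ltr_pwDl.
apply: (@lt_le_trans _ _ (e / (1 + `|a|))%:E); last first.
  by rewrite lee_fin ler_pdivrMr//; apply: ler_peMr; rewrite ?lerDl// ltW.
apply: le_lt_trans uu.
apply: ae_le_measure => //.
near=> x => /=.
have -> // := near (L0Z a u) x.
have -> // := near (L0Z a u') x.
rewrite /= -mulrBr normrM => h; rewrite ler_pdivrMr// (le_trans h)// mulrC.
by rewrite ler_wpM2l// lerDr.
Unshelve. all: by end_near. Qed.

Lemma L0_integrable (u : L0) (g : T -> \bar R) :
  EFin \o u = g %[ae mu] -> mu.-integrable setT g ->
  mu.-integrable setT (EFin \o u).
Proof.
move=> ug /integrableP[mg ig].
have mu' : measurable_fun setT (EFin \o u).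
  by apply/measurable_EFinP; exact: L0_measurable.
apply/integrableP; split=> //; apply: le_lt_trans ig.
rewrite le_eqVlt; apply/orP; left; apply/eqP; apply: ge0_ae_eq_integral => //.
- exact: measurableT_comp.
- exact: measurableT_comp.
- by apply: filterS ug => x h xT /=; rewrite -h.
Qed.

Lemma L0_closure_submod (A : set L0) :
  submod_closed (mem A) -> submod_closed (mem (closure A)).
Proof.
move=> [A0 Aad]; split; first by apply/mem_set/subset_closure; exact: set_mem.
move=> a u v /set_mem cu /set_mem cv; apply/mem_set.
move=> B /nbhs_ballP[e /= e0 eB].
have e20 : 0 < e / 2 by rewrite divr_gt0.
have a0 : 0 < 1 + `|a| by rewrite ltr_pwDl.
have [u' [Au' uu']] := cu _ (nbhsx_ballx u _ (divr_gt0 e20 a0)).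
have [v' [Av' vv']] := cv _ (nbhsx_ballx v _ e20).
exists (a *: u' + v'); split; first exact/set_mem/Aad/mem_set/Av'/mem_set.
by apply: eB; apply: L0_ballD => //; exact: L0_ballZ.
Qed.

End L0_theory.

(* Measurable types are required to be pointed. *)
HB.instance Definition _ (R : numDomainType) (X : tvsType R) :=
  isPointed.Build X 0.

Notation borel X := (g_sigma_algebraType (@open X)).

Lemma continuous_borel_measurable {R : realType} {X : tvsType R}
  (f : X -> R) : continuous f -> measurable_fun [set: borel X] f.
Proof.
move=> /continuousP cf; apply: (measurability _ (RGenOpens.measurableE R)).
move=> _ [_ [a [b ->] <-]]; rewrite setTI; apply: sub_sigma_algebra.
exact: cf (interval_open _ _).
Qed.

Section cumulant.
Context {R : realType} {X : tvsType R}.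
Variable mu : probability (borel X) R.

Definition Kmu : set (L0 mu) :=
  [set T | exists (phi : {linear X -> R^o}) (cphi : continuous phi),
    T = cls mu (continuous_borel_measurable cphi)].

Definition Mmu : set (L0 mu) := closure Kmu.

(* The formula for V_mu makes sense on all of L^0(mu); only its values on
   K(mu) are used. *)
Definition Vmu (T : L0 mu) : \bar R := lne (\int[mu]_x (expR (T x))%:E)%E.

(* Lower semicontinuous functions on M(mu) whose restriction to K(mu) is at
   most V_mu; Mmu is coerced to a type carrying the subset topology. *)
Definition lsc_minorant : set (Mmu -> \bar R) :=
  [set G | lower_semicontinuous G /\
    forall S : Mmu, Kmu (\val S) -> (G S <= Vmu (\val S))%E].

Definition Wbar (T : Mmu) : \bar R :=
  ereal_sup [set G T | G in lsc_minorant].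

Lemma Wbar_greatest :
  lsc_minorant Wbar /\
  forall G, lsc_minorant G -> forall T, (G T <= Wbar T)%E.
Proof.
split; last by move=> G mG T; apply: ereal_sup_ubound; exists G.
split.
  move=> T a /ereal_sup_gt[_ [G mG <-]] aG.
  have [V TV aV] := mG.1 _ _ aG; exists V => // S /aV /lt_le_trans; apply.
  by apply: ereal_sup_ubound; exists G.
by move=> S KS; apply: ge_ereal_sup => _ [G mG <-]; exact: mG.2.
Qed.

Definition Lset : set (L0 mu) :=
  Mmu `&` [set T : L0 mu | mu.-integrable setT (EFin \o T)].

Lemma Kmu_submod : submod_closed (mem Kmu).
Proof.
split.
  apply/mem_set; exists \0%R.
  have c0 : continuous (\0%R : X -> R^o) by move=> x; exact: cvg_cst.
  exists c0; apply/L0_eqP; apply: ae_eq_trans (L00 mu) _.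
  exact/ae_eq_sym/clsE.
move=> a _ _ /set_mem[f [cf ->]] /set_mem[g [cg ->]]; apply/mem_set.
pose h : {linear X -> R^o} := a \*: f \+ g.
have ch : continuous h.
  by move=> x; apply: cvgD; [apply: cvgZr; exact: cf|exact: cg].
exists h, ch; apply/L0_eqP; near=> x => xT.
set u := cls mu _; set v := cls mu _; set w := cls mu _.
have -> // := near (L0D (a *: u) v) x.
rewrite /=.
have -> // := near (L0Z a u) x.
rewrite /=.
have -> // := near (clsE mu (continuous_borel_measurable cf)) x.
have -> // := near (clsE mu (continuous_borel_measurable cg)) x.
by have -> // := near (clsE mu (continuous_borel_measurable ch)) x.
Unshelve. all: by end_near. Qed.

Definition Lpred : {pred L0 mu} := mem Lset.

Lemma Lpred_submod : submod_closed Lpred.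
Proof.
have [M0 MD] := L0_closure_submod Kmu_submod.
split.
  apply/mem_set; split; first exact/set_mem.
  apply: (@L0_integrable _ _ _ _ _ (cst 0%E)); last exact: integrable0.
  by near=> x => xT /=; have -> // := near (L00 mu) x.
move=> a u v /set_mem[Mu iu] /set_mem[Mv iv]; apply/mem_set; split.
  by apply/set_mem/MD; exact/mem_set.
apply: (@L0_integrable _ _ _ _ _
  (fun x => a%:E * (L0_fun u x)%:E + (L0_fun v x)%:E)%E).
  near=> x => xT /=.
  have -> // := near (L0D (a *: u) v) x.
  rewrite /=.
  by have -> // := near (L0Z a u) x.
by apply: integrableD => //; exact: integrableZl.
Unshelve. all: by end_near. Qed.

HB.instance Definition _ := GRing.isSubmodClosed.Build R (L0 mu) Lpred
  Lpred_submod.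

Record Lmu : Type := MkLmu { Lval :> L0 mu; LvalP : Lval \in Lpred }.

HB.instance Definition _ := [isSub for Lval].
HB.instance Definition _ := [Choice of Lmu by <:].
HB.instance Definition _ := [SubChoice_isSubLmodule of Lmu by <:].

Lemma Lmu_in_M (T : Lmu) : Lval T \in Mmu.
Proof. by apply/mem_set; case: T => T /= /set_mem[]. Qed.

Definition Wmu (T : Lmu) : \bar R := Wbar (exist _ (Lval T) (Lmu_in_M T)).

Definition pmu (T : Lmu) : R := \int[mu]_x (Num.max (- T x) 0).

Definition pbarmu (T : Lmu) : R := pmu (- T).

End cumulant.

Arguments Wmu {R X} mu T.
Arguments pmu {R X} mu T.
Arguments pbarmu {R X} mu T.

(* Duality for an asymmetric norm q on a real vector space E. Functionals on E
   are plain functions, and the dual cone (E, q)^* is a set of functions. *)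
Section asymmetric.
Context {R : realType} {E : lmodType R}.
Implicit Types (q : E -> R) (z u y : E -> R) (F : E -> \bar R).

Definition dual_cone q : set (E -> R) :=
  [set z | scalar z /\ exists2 C, 0 <= C & forall T, z T <= C * q T].

Definition dual_cone_norm q z : \bar R :=
  ereal_sup [set (z T)%:E | T in [set T | q T < 1]].

(* The filter with basis {u + z | z in (E, q)^*, ||z|| < r}, r > 0. *)
Definition dual_cone_nbhs q u : set_system (E -> R) :=
  filter_from [set r : R | 0 < r]
    (fun r => [set u \+ z | z in
       [set z | dual_cone q z /\ (dual_cone_norm q z < r%:E)%E]]).

Definition sym_norm q (T : E) : R := Num.max (q T) (q (- T)).

(* The dual norm of the symmetrised norm max {q(T), q(-T)}. *)
Definition sym_dual_norm q z : \bar R :=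
  ereal_sup [set `|z T|%:E | T in [set T | sym_norm q T <= 1]].

Definition conjugate F y : \bar R :=
  ereal_sup [set ((y T)%:E - F T)%E | T in setT].

Definition weak_cvg q (Tn : nat -> E) (T : E) : Prop :=
  forall z, dual_cone q z -> (limn_esup (fun n => (z (Tn n - T))%:E) <= 0)%E.

(* L = D Phi(u), for Phi and L defined on the cone Y = (E, q)^*; the values of
   Phi and L outside Y are irrelevant. *)
Definition is_right_gateaux q (Phi : (E -> R) -> \bar R) (u : E -> R)
    (L : (E -> R) -> R) : Prop :=
  let Y := dual_cone q in
  [/\ Phi u \is a fin_num,
      forall (a b : R) v w, 0 <= a -> 0 <= b -> Y v -> Y w ->
        L (a \*o v \+ b \*o w) = a * L v + b * L w,
      forall v, Y v -> L w @[w --> dual_cone_nbhs q v] --> L v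
    & forall v, Y v ->
        (t^-1%:E * (Phi (u \+ t \*o v)%R - Phi u - (t * L v)%:E))%E
          @[t --> 0^'+] --> 0%E].

Definition minimising (F : E -> \bar R) (Tn : nat -> E) : Prop :=
  F (Tn n) @[n --> \oo] --> ereal_inf (range F).

End asymmetric.

(* Main.v *)
Require Import Defs.
From mathcomp Require Import all_boot all_order all_algebra.
From mathcomp Require Import all_classical all_reals all_analysis.
From mathcomp Require Import measurable_realfun ring lra.

Set Implicit Arguments.
Unset Strict Implicit.
Unset Printing Implicit Defensive.

Import Order.TTheory GRing.Theory Num.Theory.
Import numFieldNormedType.Exports.

Local Open Scope classical_set_scope.
Local Open Scope ring_scope.

(** Write [m] for the infimum of [W - y]. The boundedness hypothesis, applied to
    the perturbations [e y + (1 + e) t v] of [y], bounds [W] on every sublevel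
    set of [W - y - t v], uniformly for small [t] ([coercive]). An upper bound on
    [W] bounds [int exp T], so positive parts are uniformly integrable, and, the
    elements of K(mu) being centred, it also bounds the negative parts in L1.
    Hence, under such a bound, convergence almost everywhere to [S] forces
    [int (T_n - S)^+ -> 0] ([pbarmu_sub_cvg]): every [z] in the dual cone
    satisfies [limsup z (T_n - S) <= 0].

    No weak compactness is needed, because [W] is uniformly convex in the
    following sense ([Wmu_midpoint_gap]): if [T_1], [T_2] have values [w_1],
    [w_2], the defect [w_1 + w_2 - 2 W ((T_1 + T_2) / 2)] dominates the squared
    L2-distance of [exp ((T_1 - w_1) / 2)] and [exp ((T_2 - w_2) / 2)]. Along a
    minimising sequence the defect tends to 0, so these square-root densities
    are Cauchy in L2; after passing to a subsequence along which the values of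
    [W] converge, the sequence itself converges almost everywhere
    ([Wmu_fast_cvg]), and its limit is a minimiser ([compact_minimising]).

    Minimisers need not be unique: M(mu) may contain non-zero constants, and
    [W - y] may be constant on a segment in their direction. The midpoint
    estimate shows that this is the only ambiguity: two minimisers differ by the
    constant [W T_1 - W T_2 = y T_1 - y T_2]. Let [T] be the minimiser with the
    largest [y T]. Every other one lies below [T], and elements of the dual cone are
    monotone, so [z (S - T) <= 0] for each minimiser [S]. Together with the
    compactness this gives [max_minimiser]: for all [z] in the dual cone and
    [d > 0], all nearly minimal [S] satisfy [z (S - T) < d]. The asymmetric weak
    convergence is a restatement. For the derivative, [z (T)] is a lower bound
    for the difference quotients since [T] is a competitor, and any [S] exceeding
    the upper bound at [y + t v] would be nearly minimal for [W - y], whence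
    [v (S - T) < d], which is incompatible with that excess. *)

(** * Real analysis and measure theory *)

Lemma lee_subl_real {R : realType} (a b : R) (w : \bar R) :
  (a%:E - w <= b%:E)%E = ((a - b)%:E <= w)%E.
Proof.
case: w => [w| |]; last 2 first.
- by rewrite leey leNye.
- by rewrite addey// leye_eq leeNy_eq.
by rewrite -EFinB !lee_fin lerBlDr addrC -lerBlDr.
Qed.

Lemma limn_esup_le0 {R : realType} (u : nat -> R) :
  (forall d, 0 < d -> \forall n \near \oo, u n < d) ->
  (limn_esup (fun n => (u n)%:E) <= 0)%E.
Proof.
move=> ud; apply/lee_addgt0Pr => d d0; rewrite add0e.
rewrite limn_esup_lim; apply: lime_le; first exact: is_cvg_esups.
have [N _ Nd] := ud d d0; exists N => // n /= Nn.
apply: ge_ereal_sup => _ [k /= nk <-]; rewrite lee_fin ltW//.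
by apply: Nd => /=; exact: leq_trans nk.
Qed.

Lemma cvg_max0 {R : realType} (u : nat -> R) (l : R) : u @ \oo --> l ->
  (fun n => Num.max (u n) 0) @ \oo --> Num.max l 0.
Proof.
move=> ul; rewrite maxr_absE; under eq_fun do rewrite maxr_absE addr0 subr0.
rewrite addr0 subr0; apply: cvgM; last exact: cvg_cst.
by apply: cvgD => //; exact: cvg_norm.
Qed.

Section measure_lemmas.
Context {d} {T : measurableType d} {R : realType} (P : probability T R).

Lemma measurable_limn_einf (f_ : nat -> T -> R) :
  (forall n, measurable_fun setT (f_ n)) ->
  measurable_fun setT (fun x => limn_einf (fun n => (f_ n x)%:E)).
Proof.
move=> mf.
have : measurable_fun setT (fun x => - limn_esup (fun n => - (f_ n x)%:E))%E.
  apply: measurableT_comp => //; apply: measurable_fun_limn_esup => n.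
  by apply: measurableT_comp => //; exact/measurable_EFinP.
exact.
Qed.

Lemma limn_einf_ge0 (u : nat -> R) : (forall n, 0 <= u n) ->
  (0 <= limn_einf (fun n => (u n)%:E))%E.
Proof.
move=> u0; rewrite limn_einf_lim; apply: lime_ge; first exact: is_cvg_einfs.
by apply: nearW => n; apply: le_ereal_inf_tmp => _ [m _ <-]; rewrite lee_fin.
Qed.

Lemma fatou_ae (f_ : nat -> T -> R) (f : T -> R) (c_ : nat -> R) (c : R) :
  (forall n, measurable_fun setT (f_ n)) -> measurable_fun setT f ->
  (forall n x, 0 <= f_ n x) -> (forall x, 0 <= f x) ->
  {ae P, forall x, f_ ^~ x @ \oo --> f x} ->
  (forall n, \int[P]_x (f_ n x)%:E <= (c_ n)%:E)%E -> c_ @ \oo --> c ->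
  (\int[P]_x (f x)%:E <= c%:E)%E.
Proof.
move=> mf_ mf f_0 f0 f_f If_ c_c.
have mEf_ n : measurable_fun setT (EFin \o f_ n) by exact/measurable_EFinP.
rewrite (@ge0_ae_eq_integral _ _ _ P setT _
    (fun x => limn_einf (fun n => (f_ n x)%:E)))//.
- apply: le_trans (fatou P measurableT mEf_ _) _.
    by move=> n x _; rewrite lee_fin.
  have : (EFin \o c_) @ \oo --> c%:E by exact: cvg_comp c_c _.
  move=> /cvg_limn_einf_sup[<- _].
  rewrite !limn_einf_lim; apply: lee_lim; [exact: is_cvg_einfs|exact: is_cvg_einfs|].
  apply: nearW => n; apply: le_ereal_inf_tmp => _ [m nm <-].
  by apply: le_trans (If_ m); apply: ereal_inf_lbound; exists m.
- exact/measurable_EFinP.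
- exact: measurable_limn_einf.
- by move=> x _; rewrite lee_fin.
- by move=> x _; exact: limn_einf_ge0.
- apply: filterS f_f => x fx _ /=.
  by have /cvg_limn_einf_sup[->] : (fun n => (f_ n x)%:E) @ \oo --> (f x)%:E
    by exact: cvg_comp fx _.
Qed.

(** Fatou makes the lower limit integrable, hence finite almost everywhere. *)
Lemma ae_not_cvgy (f_ : nat -> T -> R) (C : R) :
  (forall n, measurable_fun setT (f_ n)) -> (forall n x, 0 <= f_ n x) ->
  (forall n, \int[P]_x (f_ n x)%:E <= C%:E)%E ->
  {ae P, forall x, ~ ((fun n => (f_ n x)%:E) @ \oo --> +oo%E)}.
Proof.
move=> mf f0 If.
have mEf n : measurable_fun setT (EFin \o f_ n) by exact/measurable_EFinP.
pose g x := limn_einf (fun n => (f_ n x)%:E).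
have g0 x : (0 <= g x)%E by exact: limn_einf_ge0.
have ig : P.-integrable setT g.
  apply/integrableP; split; first exact: measurable_limn_einf.
  under eq_integral do rewrite gee0_abs//.
  apply: (@le_lt_trans _ _ C%:E); last exact: ltry.
  apply: le_trans (fatou P measurableT mEf _) _.
    by move=> n x _; rewrite lee_fin.
  rewrite limn_einf_lim; apply: lime_le; first exact: is_cvg_einfs.
  apply: nearW => n; apply: le_trans (If n); apply: ereal_inf_lbound.
  by exists n => //=.
apply: filterS (integrable_ae measurableT ig) => x /(_ I) gx /cvg_limn_einf_sup[fy _].
by move: gx; rewrite /g fy.
Qed.

(** A bound on the exponentials makes the positive parts uniformly integrable.
    Truncate at the level [N]: the truncated part is treated by dominated
    convergence, and the excess [x - N] is at most [4 exp x / N], because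
    [exp x = (exp (x / 2))^2 >= x^2 / 4] for [x >= 0]. *)
Lemma int_maxB_cvg0 (f_ : nat -> T -> R) (f : T -> R) (C : R) :
  (forall n, measurable_fun setT (f_ n)) -> measurable_fun setT f ->
  P.-integrable setT (EFin \o f) ->
  {ae P, forall x, f_ ^~ x @ \oo --> f x} ->
  (forall n, \int[P]_x (expR (f_ n x))%:E <= C%:E)%E ->
  forall e, 0 < e -> \forall n \near \oo,
    (\int[P]_x (Num.max (f_ n x - f x) 0)%:E <= e%:E)%E.
Proof.
move=> mf_ mf intf f_f If_ e e0.
have C0 : 0 <= C.
  rewrite -lee_fin; apply: le_trans (If_ 0%N); apply: integral_ge0 => x _.
  by rewrite lee_fin expR_ge0.
pose N := 8 * (C + 1) / e.
have N0 : 0 < N by rewrite divr_gt0// mulr_gt0// ltr_wpDl.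
pose h n x := Num.max (Num.min (f_ n x) N - f x) 0.
have mh n : measurable_fun setT (h n).
  apply: measurable_maxr => //; apply: measurable_funB => //.
  exact: measurable_minr.
have h0 n x : 0 <= h n x by rewrite le_max lexx orbT.

have hcvg : (\int[P]_x (h n x)%:E)%E @[n --> \oo] --> 0%E.
  have [||||//|_ _] := @dominated_convergence _ _ _ P setT measurableT
    (fun n x => (h n x)%:E) (cst 0%E) (fun x => N%:E + `|(f x)%:E|)%E.
  - by move=> n; apply/measurable_EFinP.
  - exact: measurable_cst.
  - apply: filterS f_f => x fx _.
    have : h ^~ x @ \oo --> 0.
      apply: (@squeeze_cvgr _ _ _ _ (cst 0) (fun n => `|f_ n x - f x|)).
      - apply: nearW => n; rewrite h0/= ge_max normr_ge0 andbT.
        by rewrite (le_trans _ (ler_norm _))// lerB// ge_min lexx.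
      - exact: cvg_cst.
      - have -> : 0 = `|f x - f x| by rewrite subrr normr0.
        by apply: cvg_norm; apply: cvgB => //; exact: cvg_cst.
    by move=> hx; exact: cvg_comp hx _.
  - apply: integrableD => //; last exact: integrable_abse.
    exact: finite_measure_integrable_cst.
  - apply: aeW => x n _; rewrite lee_fin ger0_norm//.
    rewrite ge_max; apply/andP; split; last by rewrite addr_ge0// ltW.
    by rewrite lerD// ?ge_min ?lexx ?orbT// -normrN ler_norm.
  by rewrite integral_cst// mul0e.
have e20 : 0 < e / 2 by rewrite divr_gt0.
have nh : \forall n \near \oo, (\int[P]_x (h n x)%:E < (e / 2)%:E)%E.
  by apply: (hcvg [set z | (z < (e / 2)%:E)%E]); apply: open_ereal_lt'; rewrite lte_fin.
near=> n.
apply: (@le_trans _ _ (\int[P]_x ((h n x)%:E + (4 / N)%:E * (expR (f_ n x))%:E))%E).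
  apply: ge0_le_integral => //.
  - by move=> x _; rewrite lee_fin le_max lexx orbT.
  - by apply/measurable_EFinP/measurable_maxr => //; exact: measurable_funB.
  - apply: emeasurable_funD; first exact/measurable_EFinP.
    by apply/measurable_EFinP; apply: measurable_funM => //; exact: measurableT_comp.
  - move=> x _; rewrite -EFinM -EFinD lee_fin.
    have e0x : 0 <= 4 / N * expR (f_ n x).
      by rewrite mulr_ge0 ?expR_ge0// divr_ge0// ltW.
    have [fN|Nf] := leP (f_ n x) N.
      by rewrite /h (min_idPl fN) lerDl.
    rewrite /h (min_idPr (ltW Nf)).
    have : f_ n x <= 4 / N * expR (f_ n x).
      have -> : expR (f_ n x) = expR (f_ n x / 2) * expR (f_ n x / 2).
        by rewrite -expRD -splitr.
      have := expR_ge1Dx (f_ n x / 2); set E := expR _ => fE.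
      have fn0 : 0 < f_ n x by exact: lt_trans Nf.
      rewrite mulrAC ler_pdivlMr//.
      apply: (@le_trans _ _ (f_ n x * f_ n x)); first by rewrite ler_pM2l// ltW.
      nra.
    rewrite ge_max; move: e0x; set E := _ * expR _ => e0x fE.
    have m1 : N - f x <= Num.max (N - f x) 0 by rewrite le_max lexx.
    have m0 : 0 <= Num.max (N - f x) 0 by rewrite le_max lexx orbT.
    by apply/andP; split; lra.
rewrite ge0_integralD//; first last.
- by apply/measurable_EFinP; apply: measurable_funM => //; exact: measurableT_comp.
- by move=> x _; rewrite mule_ge0// lee_fin ?expR_ge0// divr_ge0// ltW.
- exact/measurable_EFinP.
- by move=> x _; rewrite lee_fin.
rewrite ge0_integralZl_EFin//; first last.
- by rewrite divr_ge0// ltW.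
- by apply/measurable_EFinP; exact: measurableT_comp.
rewrite [e]splitr EFinD; apply: leeD.
  by apply: ltW; near: n.
apply: (@le_trans _ _ ((4 / N)%:E * C%:E)%E).
  by rewrite lee_pmul2l// lte_fin divr_gt0.
rewrite -EFinM lee_fin mulrAC ler_pdivrMr// /N.
rewrite (_ : e / 2 * _ = 4 * (C + 1)); last by field; rewrite gt_eqF.
by rewrite ler_pM2l// lerDl.
Unshelve. all: by end_near. Qed.

(** The series of the increments is integrable, hence absolutely convergent almost
    everywhere. *)
Lemma ae_cvg_summable (r : nat -> T -> R) :
  (forall n, measurable_fun setT (r n)) ->
  (\sum_(n <oo) \int[P]_x `|r n.+1 x - r n x|%:E < +oo)%E ->
  {ae P, forall x, cvgn (r ^~ x)}.
Proof.
move=> mr sr.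
pose D n x := `|r n.+1 x - r n x|%:E.
have mD n : measurable_fun setT (D n).
  apply/measurable_EFinP; apply: measurableT_comp => //.
  exact: measurable_funB.
have D0 n x : (0 <= D n x)%E by rewrite lee_fin.
have iD : P.-integrable setT (fun x => \sum_(n <oo) D n x)%E.
  apply/integrableP; split.
    exact: ge0_emeasurable_sum.
  under eq_integral do rewrite gee0_abs ?nneseries_ge0//.
  by rewrite integral_nneseries.
have := integrable_ae measurableT iD; apply: filterS => x /(_ I) fx.
have cD : cvgn [normed series (telescope (r ^~ x))].
  apply: nondecreasing_is_cvgn.
    by apply: nondecreasing_series => n _ _; exact: normr_ge0.
  exists (fine (\sum_(n <oo) D n x)%E) => _ [n _ <-].
  rewrite -lee_fin fineK//.
  apply: le_trans (nneseries_lim_ge n _); last by move=> *; exact: D0.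
  by rewrite /series/= -sumEFin.
have /cvg_ex[l cl] := normed_cvg cD; apply/cvg_ex; exists (r 0%N x + l).
rewrite (_ : r ^~ x = fun n => r 0%N x + series (telescope (r ^~ x)) n).
  by apply: cvgD => //; exact: cvg_cst.
by apply/funext => n; rewrite [LHS](eq_sum_telescope (r ^~ x)).
Qed.

Lemma measurable_gap (u v : L0 P) (e : R) :
  measurable [set x | e <= `|u x - v x|].
Proof.
rewrite -[X in measurable X]setTI.
have mf : measurable_fun setT (fun x => `|u x - v x|).
  apply: measurableT_comp => //.
  by apply: measurable_funB; exact: L0_measurable.
rewrite (_ : [set x | _] = (fun x => `|u x - v x|) @^-1` `[e, +oo[).
  exact: mf.
by apply/seteqP; split=> x /=; rewrite in_itv/= andbT.
Qed.

(** Borel-Cantelli, the radii being summable. *)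
Lemma ae_cvg_L0_ball (u : L0 P) (u_ : nat -> L0 P) :
  (forall n, L0_ball u (2 ^- n.+1) (u_ n)) ->
  {ae P, forall x, (fun n => u_ n x) @ \oo --> u x}.
Proof.
move=> uu.
pose F n := [set x | 2 ^- n.+1 <= `|u x - u_ n x|].
have mF n : measurable (F n) by exact: measurable_gap.
have s0 : P (lim_sup_set F) = 0%E.
  apply: lim_sup_set_cvg0 => //.
  apply: (@le_lt_trans _ _ (\sum_(n <oo) (1 / (2 ^ n.+1)%:R)%:E)%E).
    apply: lee_nneseries => // n _.
    by apply: le_trans (ltW (uu n)) _; rewrite lee_fin div1r natrX.
  by apply: le_lt_trans (@epsilon_trick0 R 1 xpredT ler01) _; rewrite ltry.
exists (lim_sup_set F); split => //.
  by apply: bigcap_measurable => // k _; exact: bigcup_measurable.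
move=> x /= nc; apply: contrapT => nF; apply: nc.
have [N nN] : exists N, forall n, (N <= n)%N -> `|u x - u_ n x| < 2 ^- n.+1.
  apply: contrapT => h; apply: nF => N _; apply: contrapT => h'; apply: h.
  exists N => n Nn; rewrite ltNge; apply/negP => le; apply: h'.
  by exists n.
apply/cvgrPdist_lt => e e0.
have e1 := near_infty_natSinv_expn_lt (PosNum e0).
near=> n.
apply: lt_trans (nN n _) _; first by near: n; exists N.
apply: (@le_lt_trans _ _ (1 / 2 ^+ n)); last by near: n.
by rewrite div1r lef_pV2 ?posrE ?exprn_gt0// ler_eXn2l ?ltr1n.
Unshelve. all: by end_near. Qed.

(** By Egorov's theorem. *)
Lemma near_L0_ball (u : L0 P) (u_ : nat -> L0 P) :
  {ae P, forall x, (fun n => u_ n x) @ \oo --> u x} ->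
  forall e, 0 < e -> \forall n \near \oo, L0_ball u e (u_ n).
Proof.
move=> uu e e0; have P1 : (P setT < +oo)%E by rewrite probability_setT ltry.
have [||||||B [mB Be uB]] := @ae_pointwise_almost_uniform _ _ _ P
   (fun n => u_ n) u setT e => //.
- by apply: filterS uu => x ux _.
have uB' : \forall n \near \oo, forall x, (setT `\` B) x -> `|u x - u_ n x| < e.
  apply: (uB [set h | forall x, (setT `\` B) x -> `|u x - h x| < e]).
  apply/uniform_nbhs; exists [set xy | ball xy.1 e xy.2]; split.
    by rewrite -entourage_ballE; exists e.
  by move=> h.
near=> n; have uB2 : forall x, (setT `\` B) x -> `|u x - u_ n x| < e by near: n.
apply: le_lt_trans Be; apply: le_measure; rewrite ?inE//.
- exact: measurable_gap.
- move=> x /= ex; apply: contrapT => nB; have := uB2 x (conj I nB).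
  by rewrite ltNge ex.
Unshelve. all: by end_near. Qed.

End measure_lemmas.

(** * The lower semicontinuous hull of the cumulant-generating function *)

Section Wmu_theory.
Context {R : realType} {X : tvsType R} (mu : probability (borel X) R).

Lemma measurable_expL0 (T : L0 mu) : measurable_fun setT (fun x => (expR (T x))%:E).
Proof.
apply/measurable_EFinP; apply: measurableT_comp => //; exact: L0_measurable.
Qed.

Lemma Vmu_le (T : L0 mu) (a : R) :
  (Vmu T <= a%:E)%E = (\int[mu]_x (expR (T x))%:E <= (expR a)%:E)%E.
Proof.
rewrite -(lee_expeR (Vmu T)) /Vmu lneK// in_itv/= leey andbT.
by apply: integral_ge0 => x _; rewrite lee_fin expR_ge0.
Qed.

Lemma Vmu_ge (T : L0 mu) (a : R) :
  (a%:E <= Vmu T)%E = ((expR a)%:E <= \int[mu]_x (expR (T x))%:E)%E.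
Proof.
rewrite -(lee_expeR a%:E) /Vmu lneK// in_itv/= leey andbT.
by apply: integral_ge0 => x _; rewrite lee_fin expR_ge0.
Qed.

(** Lower semicontinuity of [Wbar], read on the elements of K(mu) near [T]. *)
Lemma Wmu_gt (T : Lmu mu) (a : R) : (a%:E < Wmu mu T)%E ->
  exists2 e, 0 < e & forall phi : L0 mu, Kmu phi -> L0_ball T e phi ->
    (a%:E < Vmu phi)%E.
Proof.
move=> aW; have [lscW W_le] := (Wbar_greatest mu).1.
have [V TV aV] := lscW _ _ aW.
have [e e0 eV] : exists2 e, 0 < e & forall S : @Mmu R X mu, L0_ball T e (\val S) -> V S.
  move: TV => [_ [[B oB <-] BT BV]].
  have /nbhs_ballP[e e0 eB] : nbhs (Lval T) B.
    by apply: open_nbhs_nbhs; split.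
  by exists e => // S TS; apply: BV; exact: eB.
exists e => // phi Kphi Tphi.
have Mphi : phi \in @Mmu R X mu by apply/mem_set/subset_closure.
pose S : @Mmu R X mu := exist _ phi Mphi.
by apply: lt_le_trans (aV S (eV S Tphi)) _; exact: (W_le S).
Qed.

(** If [V >= a] on the elements of K(mu) in some ball around [T], the function
    equal to [a] on the interior of the ball and to [-oo] elsewhere is a lower
    semicontinuous minorant, so that [a <= W T] by maximality. *)
Lemma Wmu_lt (T : Lmu mu) (a : R) : (Wmu mu T < a%:E)%E ->
  forall e, 0 < e -> exists phi : L0 mu, 
    [/\ Kmu phi, L0_ball T e phi & (Vmu phi < a%:E)%E].
Proof.
move=> Wa e e0; apply: contrapT => h.
pose B : set (L0 mu) := [set S | L0_ball T e S].
pose G (S : @Mmu R X mu) : \bar R := if `[< nbhs (\val S) B >] then a%:E else -oo%E.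
have [_ Wmax] := Wbar_greatest mu.
suff mG : lsc_minorant G.
  have := Wmax _ mG (exist _ (Lval T) (Lmu_in_M T)); rewrite /G.
  case: asboolP => [_|nB].
    by move=> /(lt_le_trans Wa); rewrite ltxx.
  by exfalso; apply: nB; exact: nbhsx_ballx.
split.
  move=> S r; rewrite /G; case: asboolP => // SB ra.
  exists (\val @^-1` B°).
    exists (\val @^-1` B°); split => //.
    by exists B° => //; exact: open_interior.
  by move=> S' S'B; case: asboolP => //; exact.
move=> S KS; rewrite /G; case: asboolP => [/nbhs_singleton BS|_]; last exact: leNye.
rewrite leNgt; apply/negP => Va; apply: h.
by exists (\val S); split.
Qed.

Lemma Wmu_le (T : Lmu mu) (w : R) :
  (forall e, 0 < e -> exists phi : L0 mu,
    [/\ Kmu phi, L0_ball T e phi & (Vmu phi <= (w + e)%:E)%E]) ->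
  (Wmu mu T <= w%:E)%E.
Proof.
move=> h; rewrite leNgt; apply/negP => wW.
have [a wa aW] : exists2 a, w < a & (a%:E < Wmu mu T)%E.
  case: (Wmu mu T) wW => [b||//]; rewrite ?lte_fin => wb.
    by exists ((w + b) / 2); rewrite ?lte_fin midf_lt.
  by exists (w + 1); rewrite ?ltrDl ?ltry.
have [e e0 he] := Wmu_gt aW.
pose e' := Num.min e (a - w).
have e'0 : 0 < e' by rewrite lt_min e0 subr_gt0.
have [phi [Kphi Tphi Vphi]] := h _ e'0.
have : (a%:E < Vmu phi)%E.
  have e'e : e' <= e by rewrite ge_min lexx.
  by apply: he => //; exact: (@le_ball _ (L0 mu) (Lval T) _ _ e'e).
apply/negP; rewrite -leNgt (le_trans Vphi)// lee_fin -lerBrDl.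
by rewrite ge_min lexx orbT.
Qed.

Hypothesis mu_integrable : forall phi : {linear X -> R^o}, continuous phi ->
  mu.-integrable [set: borel X] (fun x => (phi x)%:E).
Hypothesis mu_centred : forall phi : {linear X -> R^o}, continuous phi ->
  (\int[mu]_x (phi x)%:E = 0)%E.

Lemma Kmu_centred (phi : L0 mu) : Kmu phi ->
  mu.-integrable setT (EFin \o phi) /\ (\int[mu]_x (phi x)%:E = 0)%E.
Proof.
move=> [f [cf ->]].
have E := clsE mu (continuous_borel_measurable cf).
split.
  apply: L0_integrable (mu_integrable cf).
  by apply: filterS E => x h xT /=; rewrite -h.
rewrite -[RHS](mu_centred cf); apply: ae_eq_integral => //.
- by apply/measurable_EFinP; exact: L0_measurable.
- by have /integrableP[] := mu_integrable cf.
- by apply: filterS E => x h xT /=; rewrite -h.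
Qed.

(** Jensen: [exp phi >= 1 + phi] and [phi] is centred. *)
Lemma Vmu_ge0 (phi : L0 mu) : Kmu phi -> (0 <= Vmu phi)%E.
Proof.
move=> /Kmu_centred[iphi phi0]; rewrite /Vmu lne_ge0.
rewrite leNgt; apply/negP => lt1.
have ie : mu.-integrable setT (fun x => (expR (phi x))%:E).
  apply/integrableP; split; first exact: measurable_expL0.
  under eq_integral do rewrite gee0_abs ?lee_fin ?expR_ge0//.
  by rewrite (lt_trans lt1)// ltry.
move: lt1; apply/negP; rewrite -leNgt.
have i1 : mu.-integrable setT (cst 1%E) by exact: finite_measure_integrable_cst.
apply: (@le_trans _ _ (\int[mu]_x (cst 1%E x + (phi x)%:E))%E).
  by rewrite integralD// phi0 integral_cst// [X in (_ * X + _)%E]probability_setT mule1 adde0.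
apply: le_integral => //; first exact: integrableD.
by move=> x _; rewrite -EFinD lee_fin expR_ge1Dx.
Qed.

Lemma Wmu_ge0 (T : Lmu mu) : (0 <= Wmu mu T)%E.
Proof.
apply: ((Wbar_greatest mu).2 (cst 0%E)).
split; last by move=> S KS; exact: Vmu_ge0.
by move=> S r r0; exists setT => //; exact: filterT.
Qed.

(** Here centredness is used: [max (- phi) 0 <= exp phi - phi] pointwise and the
    integral of [phi] vanishes. *)
Lemma Kmu_neg (phi : L0 mu) : Kmu phi ->
  (\int[mu]_x (Num.max (- phi x) 0)%:E <= \int[mu]_x (expR (phi x))%:E)%E.
Proof.
move=> /Kmu_centred[iphi phi0].
have [->|] := eqVneq (\int[mu]_x (expR (phi x))%:E)%E +oo%E; first exact: leey.
rewrite -ltey => ltoo.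
have ie : mu.-integrable setT (fun x => (expR (phi x))%:E).
  apply/integrableP; split; first exact: measurable_expL0.
  by under eq_integral do rewrite gee0_abs ?lee_fin ?expR_ge0//.
apply: (@le_trans _ _ (\int[mu]_x ((expR (phi x))%:E - (phi x)%:E))%E).
  apply: ge0_le_integral => //.
  - by move=> x _; rewrite lee_fin le_max lexx orbT.
  - apply/measurable_EFinP/measurable_maxr => //.
    by apply: measurableT_comp => //; exact: L0_measurable.
  - apply: emeasurable_funB; first exact: measurable_expL0.
    by apply/measurable_EFinP; exact: L0_measurable.
  - move=> x _; rewrite -EFinB lee_fin ge_max.
    have := expR_ge1Dx (phi x); have := expR_ge0 (phi x).
    by set e := expR _ => e0 e1; apply/andP; split; lra.
by rewrite integralB// phi0 sube0.
Qed.

(** A sequence in K(mu) that recovers the value of [W]; the speed [2 ^- n.+1] in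
    measure makes it converge almost everywhere. *)
Lemma Wmu_seq (T : Lmu mu) (w : R) : (Wmu mu T <= w%:E)%E ->
  exists phi_ : nat -> L0 mu, [/\ forall n, Kmu (phi_ n),
    {ae mu, forall x, (fun n => phi_ n x) @ \oo --> T x} &
    forall n, (\int[mu]_x (expR (phi_ n x))%:E <= (expR (w + harmonic n))%:E)%E].
Proof.
move=> Ww.
have ex n : exists phi, [/\ Kmu phi, L0_ball (Lval T) (2 ^- n.+1) phi &
    (Vmu phi < (w + harmonic n)%:E)%E].
  apply: Wmu_lt; last by rewrite invr_gt0 exprn_gt0.
  by apply: le_lt_trans Ww _; rewrite lte_fin ltrDl harmonic_gt0.
have [phi_ h] := choice ex; exists phi_; split.
- by move=> n; have [] := h n.
- by apply: ae_cvg_L0_ball => n; have [] := h n.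
- by move=> n; rewrite -Vmu_le ltW//; have [] := h n.
Qed.

Lemma cvg_expR_harmonic (w : R) : (fun n => expR (w + harmonic n)) @ \oo --> expR w.
Proof.
apply: continuous_cvg; first exact: continuous_expR.
rewrite -[X in _ --> X]addr0; apply: cvgD; [exact: cvg_cst|exact: cvg_harmonic].
Qed.

Lemma Wmu_expR (T : Lmu mu) (w : R) : (Wmu mu T <= w%:E)%E ->
  (\int[mu]_x (expR (T x))%:E <= (expR w)%:E)%E.
Proof.
move=> /Wmu_seq[phi_ [Kphi phiT Vphi]].
apply: (@fatou_ae _ _ _ _ (fun n x => expR (phi_ n x)) _
  (fun n => expR (w + harmonic n))) => //; last exact: cvg_expR_harmonic.
- by move=> n; apply: measurableT_comp => //; exact: L0_measurable.
- by apply: measurableT_comp => //; exact: L0_measurable.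
- apply: filterS phiT => x phix.
  by apply: continuous_cvg => //; exact: continuous_expR.
Qed.

Lemma Wmu_neg (T : Lmu mu) (w : R) : (Wmu mu T <= w%:E)%E ->
  (\int[mu]_x (Num.max (- T x) 0)%:E <= (expR w)%:E)%E.
Proof.
move=> /Wmu_seq[phi_ [Kphi phiT Vphi]].
have mneg (S : L0 mu) : measurable_fun setT (fun x => Num.max (- S x) 0).
  apply: measurable_maxr => //.
  by apply: measurableT_comp => //; exact: L0_measurable.
apply: (@fatou_ae _ _ _ _ (fun n x => Num.max (- phi_ n x) 0) _
  (fun n => expR (w + harmonic n))) => //; last exact: cvg_expR_harmonic.
- by move=> n x; rewrite le_max lexx orbT.
- by move=> x; rewrite le_max lexx orbT.
- apply: filterS phiT => x phix.
  by apply: cvg_max0; exact: cvgN.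
- by move=> n; apply: le_trans (Vphi n); exact: Kmu_neg.
Qed.

Lemma pbarmuE (T : Lmu mu) :
  (pbarmu mu T)%:E = (\int[mu]_x (Num.max (T x) 0)%:E)%E.
Proof.
have [_ iT] := set_mem (LvalP T).
have im : mu.-integrable setT (fun x => (Num.max (T x) 0)%:E).
  apply: le_integrable iT => //.
    by apply/measurable_EFinP/measurable_maxr => //; exact: L0_measurable.
  move=> x _; rewrite /= lee_fin ger0_norm ?le_max ?lexx ?orbT//.
  by rewrite ge_max ler_norm normr_ge0.
rewrite /pbarmu /pmu /Rintegral -[RHS]fineK; last exact: integrable_fin_num.
congr (fine _)%:E; apply: ae_eq_integral => //.
- apply/measurable_EFinP/measurable_maxr => //.
  by apply: measurableT_comp => //; exact: L0_measurable.
- by have /integrableP[] := im.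
near=> x => _ /=.
have -> // := near (L0N (Lval T)) x.
by rewrite /= opprK.
Unshelve. all: by end_near. Qed.

Lemma pbarmu_ge0 (T : Lmu mu) : 0 <= pbarmu mu T.
Proof.
rewrite -lee_fin pbarmuE; apply: integral_ge0 => x _.
by rewrite lee_fin le_max lexx orbT.
Qed.

Lemma Wmu_pbar (T : Lmu mu) (w : R) : (Wmu mu T <= w%:E)%E ->
  pbarmu mu T <= expR w.
Proof.
move=> /Wmu_expR; rewrite -!lee_fin pbarmuE; apply: le_trans.
apply: ge0_le_integral => //.
- by move=> x _; rewrite lee_fin le_max lexx orbT.
- by apply/measurable_EFinP/measurable_maxr => //; exact: L0_measurable.
- exact: measurable_expL0.
- move=> x _; rewrite lee_fin ge_max expR_ge0 andbT.
  by apply: le_trans (expR_ge1Dx _); rewrite lerDr.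
Qed.

(** The bound on [W] makes only the positive parts uniformly integrable, so the
    convergence is one-sided: mass of the negative parts may escape, and the
    opposite distance [pbarmu mu (S - u_ n)] need not tend to 0. *)
Lemma pbarmu_sub_cvg (u_ : nat -> Lmu mu) (S : Lmu mu) (w : R) :
  {ae mu, forall x, (fun n => L0_fun (u_ n) x) @ \oo --> S x} ->
  (forall n, Wmu mu (u_ n) <= w%:E)%E ->
  forall e, 0 < e -> \forall n \near \oo, pbarmu mu (u_ n - S) <= e.
Proof.
move=> uS uw e e0; have [_ iS] := set_mem (LvalP S).
have := @int_maxB_cvg0 _ _ _ mu (fun n => L0_fun (u_ n)) S (expR w)
  (fun n => L0_measurable _) (L0_measurable _) iS uS
  (fun n => Wmu_expR (uw n)) e e0.
apply: filterS => n; rewrite -[in X in _ -> X]lee_fin; apply: le_trans.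
rewrite pbarmuE le_eqVlt; apply/orP; left; apply/eqP.
have mmax (f : borel X -> R) : measurable_fun setT f ->
    measurable_fun setT (fun x => (Num.max (f x) 0)%:E).
  by move=> mf; apply/measurable_EFinP/measurable_maxr.
apply: ge0_ae_eq_integral => //.
- by apply: mmax; exact: L0_measurable.
- by apply: mmax; apply: measurable_funB; exact: L0_measurable.
- by move=> x _; rewrite lee_fin le_max lexx orbT.
- by move=> x _; rewrite lee_fin le_max lexx orbT.
near=> x => _ /=.
have -> // := near (L0D (Lval (u_ n)) (- Lval S)) x.
rewrite /=.
by have -> // := near (L0N (Lval S)) x.
Unshelve. all: by end_near. Qed.

(** Closedness of L(mu) and lower semicontinuity of [W] at once. The limit is
    integrable by Fatou, its positive part being controlled by the exponentials
    and its negative part by [Wmu_neg]. *)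
Lemma Lmu_limit (u_ : nat -> Lmu mu) (f : L0 mu) (c_ : nat -> R) (c : R) :
  {ae mu, forall x, (fun n => L0_fun (u_ n) x) @ \oo --> f x} ->
  (forall n, Wmu mu (u_ n) <= (c_ n)%:E)%E -> c_ @ \oo --> c ->
  exists2 S : Lmu mu, Lval S = f & (Wmu mu S <= c%:E)%E.
Proof.
move=> uf uc cc.
have appr e : 0 < e -> exists phi : L0 mu,
    [/\ Kmu phi, L0_ball f e phi & (Vmu phi <= (c + e)%:E)%E].
  move=> e0; have e20 : 0 < e / 2 by rewrite divr_gt0.
  have near1 := near_L0_ball uf e20.
  have near2 : \forall n \near \oo, c_ n < c + e.
    by apply: (cvgr_lt c) => //; rewrite ltrDl.
  have [n [fn cn]] := filter_ex (filterI near1 near2).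
  have Wn : (Wmu mu (u_ n) < (c + e)%:E)%E.
    by apply: le_lt_trans (uc n) _; rewrite lte_fin.
  have [phi [Kphi uphi Vphi]] := Wmu_lt Wn e20.
  exists phi; split => //; last exact: ltW.
  by rewrite [e]splitr; exact: (@ball_triangle _ (L0 mu) _ _ _ _ _ fn uphi).
have Mf : @Mmu R X mu f.
  move=> B /nbhs_ballP[e e0 eB]; have [phi [Kphi fphi _]] := appr e e0.
  by exists phi; split => //; exact: eB.
have Wcvg : expR (c_ n) @[n --> \oo] --> expR c.
  by apply: continuous_cvg => //; exact: continuous_expR.
have mL0 := L0_measurable.
have If : mu.-integrable setT (EFin \o f).
  apply/integrableP; split; first by apply/measurable_EFinP.
  have mneg (S : L0 mu) : measurable_fun setT (fun x => Num.max (- S x) 0).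
    apply: measurable_maxr => //.
    by apply: measurableT_comp => //; exact: L0_measurable.
  have I1 : (\int[mu]_x (expR (f x))%:E <= (expR c)%:E)%E.
    apply: (@fatou_ae _ _ _ _ (fun n x => expR (u_ n x)) _ _ _ _ _ _ _ _ _ Wcvg).
    - by move=> n; apply: measurableT_comp => //; exact: L0_measurable.
    - by apply: measurableT_comp => //; exact: L0_measurable.
    - by move=> n x; exact: expR_ge0.
    - by move=> x; exact: expR_ge0.
    - apply: filterS uf => x ufx.
      by apply: continuous_cvg => //; exact: continuous_expR.
    - by move=> n; exact: Wmu_expR.
  have I2 : (\int[mu]_x (Num.max (- f x) 0)%:E <= (expR c)%:E)%E.
    apply: (@fatou_ae _ _ _ _ (fun n x => Num.max (- u_ n x) 0) _ _ _ _ _ _ _ _ _ Wcvg) => //.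
    - by move=> n x; rewrite le_max lexx orbT.
    - by move=> x; rewrite le_max lexx orbT.
    - by apply: filterS uf => x ufx; apply: cvg_max0; exact: cvgN.
    - by move=> n; exact: Wmu_neg.
  apply: (@le_lt_trans _ _ (\int[mu]_x ((expR (f x))%:E + (Num.max (- f x) 0)%:E))%E).
    apply: ge0_le_integral => //.
    - by apply/measurable_EFinP; apply: measurableT_comp.
    - by apply: emeasurable_funD; [exact: measurable_expL0|exact/measurable_EFinP].
    - move=> x _; rewrite /= -EFinD lee_fin ler_norml.
      have := expR_ge1Dx (f x); have := expR_ge0 (f x).
      have : - f x <= Num.max (- f x) 0 by rewrite le_max lexx.
      have : 0 <= Num.max (- f x) 0 by rewrite le_max lexx orbT.
      set e := expR _; set m := Num.max _ _ => m0 m1 e0 e1.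
      by apply/andP; split; lra.
  rewrite ge0_integralD//; first last.
  - exact/measurable_EFinP.
  - by move=> x _; rewrite lee_fin le_max lexx orbT.
  - exact: measurable_expL0.
  by apply: le_lt_trans (leeD I1 I2) _; rewrite -EFinD ltry.
have Lf : f \in @Lpred R X mu by apply/mem_set; split.
exists (MkLmu Lf) => //; apply: Wmu_le => e e0; exact: appr.
Qed.

Lemma Wmu0_le0 : (Wmu mu 0%R <= 0)%E.
Proof.
have [K0 _] := Kmu_submod mu.
pose S : @Mmu R X mu := exist _ (Lval 0) (Lmu_in_M 0).
have [_ W_le] := (Wbar_greatest mu).1.
apply: le_trans (W_le S (set_mem K0)) _.
rewrite Vmu_le expR0 /= -[leRHS](probability_setT mu) -[leRHS]mul1e -integral_cst//.
rewrite le_eqVlt; apply/orP; left; apply/eqP; apply: ge0_ae_eq_integral => //.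
- exact: measurable_expL0.
near=> x => _ /=.
have -> // := near (L00 mu) x.
by rewrite /= expR0.
Unshelve. all: by end_near. Qed.

Lemma pbarmuZ (a : R) (T : Lmu mu) : 0 <= a -> pbarmu mu (a *: T) = a * pbarmu mu T.
Proof.
move=> a0; apply/eqP; rewrite -eqe EFinM !pbarmuE; apply/eqP.
have mm (S : L0 mu) : measurable_fun setT (fun x => (Num.max (S x) 0)%:E).
  by apply/measurable_EFinP/measurable_maxr => //; exact: L0_measurable.
have m0 (S : L0 mu) x : (0 <= (Num.max (S x) 0)%:E)%E.
  by rewrite lee_fin le_max lexx orbT.
rewrite -ge0_integralZl_EFin//; apply: ge0_ae_eq_integral => //.
- exact: measurable_funeM.
- by move=> x _; rewrite mule_ge0.
near=> x => _ /=.
have -> // := near (L0Z a (Lval T)) x.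
by rewrite /= -EFinM maxr_pMr// mulr0.
Unshelve. all: by end_near. Qed.

(** * The midpoint estimate and almost everywhere convergence *)

Lemma Kmu_mid (phi psi : L0 mu) : Kmu phi -> Kmu psi ->
  Kmu (2^-1 *: (phi + psi) : L0 mu).
Proof.
have [K0 KD] := Kmu_submod mu.
move=> /mem_set Kphi /mem_set Kpsi; apply/set_mem.
by rewrite scalerDr -[X in _ + X]addr0; apply: (KD) => //; apply: (KD).
Qed.

Lemma L0_midE (u v : L0 mu) :
  {ae mu, forall x, (2^-1 *: (u + v) : L0 mu) x = (u x + v x) / 2}.
Proof.
near=> x.
have -> // := near (L0Z 2^-1 (u + v)) x.
rewrite /=.
have -> // := near (L0D u v) x.
by rewrite /= mulrC.
Unshelve. all: by end_near. Qed.

(** The square root of the density [exp (u - w)]; it has L2-norm at most 1 when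
    [w] is at least the value of [V] at [u]. *)
Definition tilt (u : L0 mu) (w : R) (x : borel X) : R := expR ((u x - w) / 2).

Lemma measurable_tilt u w : measurable_fun setT (tilt u w).
Proof.
apply: measurableT_comp => //; apply: measurable_funM => //.
by apply: measurable_funB => //; exact: L0_measurable.
Qed.

Lemma int_tilt2 (u : L0 mu) (w : R) :
  (\int[mu]_x (expR (u x))%:E <= (expR w)%:E)%E ->
  (\int[mu]_x (tilt u w x ^+ 2)%:E <= 1)%E.
Proof.
move=> uw; under eq_integral => x _.
  rewrite (_ : tilt u w x ^+ 2 = expR (- w) * expR (u x)); last first.
    by rewrite expr2 /tilt -!expRD; congr expR; field.
  rewrite EFinM; over.
rewrite ge0_integralZl_EFin ?expR_ge0//; last exact: measurable_expL0.
apply: (@le_trans _ _ ((expR (- w))%:E * (expR w)%:E)%E).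
  by rewrite lee_pmul2l// lte_fin expR_gt0.
by rewrite -EFinM -expRD addNr expR0.
Qed.

(** The cross term of the square is [int exp ((u + v) / 2) / exp ((a + b) / 2)],
    which is at least [exp (c - (a + b) / 2) >= 1 + c - (a + b) / 2], while both
    square terms are at most 1. *)
Lemma int_tilt_sqrB (u v : L0 mu) (a b c : R) :
  (\int[mu]_x (expR (u x))%:E <= (expR a)%:E)%E ->
  (\int[mu]_x (expR (v x))%:E <= (expR b)%:E)%E ->
  (c%:E <= Vmu (2^-1 *: (u + v) : L0 mu))%E ->
  (\int[mu]_x ((tilt u a x - tilt v b x) ^+ 2)%:E <= (a + b - 2 * c)%:E)%E.
Proof.
move=> ua vb cV.
have mt := measurable_tilt.
set I := (\int[mu]_x _)%E.
pose J := (\int[mu]_x (tilt u a x * tilt v b x)%:E)%E.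
have mJ : measurable_fun setT (fun x => (tilt u a x * tilt v b x)%:E).
  by apply/measurable_EFinP; apply: measurable_funM.
have J0 x : (0 <= (tilt u a x * tilt v b x)%:E)%E.
  by rewrite lee_fin mulr_ge0// expR_ge0.
have IJ : (I + 2%:E * J <= 2%:E)%E.
  rewrite /I /J -ge0_integralZl_EFin// -ge0_integralD//; first last.
  - exact: measurable_funeM.
  - by move=> x _; rewrite mule_ge0.
  - by apply/measurable_EFinP; apply: measurable_funX; exact: measurable_funB.
  - by move=> x _; rewrite lee_fin sqr_ge0.
  under eq_integral => x _.
    rewrite -EFinM -EFinD (_ : _ + _ = tilt u a x ^+ 2 + tilt v b x ^+ 2); last by ring.
    rewrite EFinD; over.
  rewrite ge0_integralD//; first last.
  - by apply/measurable_EFinP; exact: measurable_funX.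
  - by move=> x _; rewrite lee_fin sqr_ge0.
  - by apply/measurable_EFinP; exact: measurable_funX.
  - by move=> x _; rewrite lee_fin sqr_ge0.
  rewrite (_ : 2%:E = 1 + 1)%E; last by rewrite -EFinD.
  by apply: leeD; exact: int_tilt2.
have cJ : ((1 + (c - (a + b) / 2))%:E <= J)%E.
  have midE : (\int[mu]_x (expR ((2^-1 *: (u + v) : L0 mu) x))%:E =
      (expR ((a + b) / 2))%:E * J)%E.
    rewrite /J -ge0_integralZl_EFin ?expR_ge0//.
    apply: ge0_ae_eq_integral => //.
    - exact: measurable_expL0.
    - exact: measurable_funeM.
    - by move=> x _; apply: mule_ge0 (J0 x); rewrite lee_fin expR_ge0.
    apply: filterS (L0_midE u v) => x -> _ /=.
    by rewrite -EFinM /tilt -!expRD; congr (expR _)%:E; field.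
  have : ((expR c)%:E <= (expR ((a + b) / 2))%:E * J)%E.
    by rewrite -midE -Vmu_ge.
  move=> h; rewrite -(@lee_pmul2l _ (expR ((a + b) / 2))%:E)// ?lte_fin ?expR_gt0//.
  apply: le_trans h; rewrite -EFinM lee_fin.
  apply: (@le_trans _ _ (expR ((a + b) / 2) * expR (c - (a + b) / 2))).
    by rewrite ler_pM2l ?expR_gt0// expR_ge1Dx.
  by rewrite -expRD addrC subrK.
have : (I + (2 * (1 + (c - (a + b) / 2)))%:E <= 2%:E)%E.
  by apply: le_trans IJ; rewrite leeD2l// EFinM lee_pmul2l.
rewrite -leeBrDr// -EFinB => h; apply: le_trans h _; rewrite lee_fin.
by lra.
Qed.

(** Apply [int_tilt_sqrB] to sequences of K(mu) recovering the values at [S1] and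
    [S2]. Their midpoints converge to the midpoint of [S1] and [S2], so by lower
    semicontinuity [V] is eventually at least [wm - e / 2] there, and Fatou passes
    to the limit in the squares. *)
Lemma Wmu_midpoint_gap (S1 S2 : Lmu mu) (w1 w2 wm : R) :
  (Wmu mu S1 <= w1%:E)%E -> (Wmu mu S2 <= w2%:E)%E ->
  (wm%:E <= Wmu mu (2^-1 *: (S1 + S2)))%E ->
  (\int[mu]_x ((tilt S1 w1 x - tilt S2 w2 x) ^+ 2)%:E <= (w1 + w2 - 2 * wm)%:E)%E.
Proof.
move=> W1 W2 Wm.
have [phi_ [Kphi phiT Vphi]] := Wmu_seq W1.
have [psi_ [Kpsi psiT Vpsi]] := Wmu_seq W2.
apply/lee_addgt0Pr => e e0; rewrite -EFinD.
have e20 : 0 < e / 2 by rewrite divr_gt0.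
pose mid n : L0 mu := 2^-1 *: (phi_ n + psi_ n).
have [r r0 hr] : exists2 r, 0 < r & forall phi : L0 mu, Kmu phi ->
    L0_ball (Lval (2^-1 *: (S1 + S2))) r phi -> ((wm - e / 2)%:E < Vmu phi)%E.
  by apply: Wmu_gt; apply: lt_le_trans Wm; rewrite lte_fin ltrBlDr ltrDl.
have midT : {ae mu, forall x, (fun n => mid n x) @ \oo --> Lval (2^-1 *: (S1 + S2)) x}.
  have mE : {ae mu, forall x, forall n, mid n x = (phi_ n x + psi_ n x) / 2}.
    by apply: ae_foralln => n; exact: L0_midE.
  near=> x.
  have -> : (fun n => mid n x) = (fun n => (phi_ n x + psi_ n x) / 2).
    by apply/funext; near: x.
  rewrite (_ : Lval (2^-1 *: (S1 + S2)) = 2^-1 *: (Lval S1 + Lval S2))//.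
  have -> // := near (L0_midE S1 S2) x.
  by apply: cvgM; [apply: cvgD; near: x|exact: cvg_cst].
(* The bound on the midpoints holds from [N] on only, hence the shifts below. *)
have [N _ NV] := near_L0_ball midT r0.
apply: (@fatou_ae _ _ _ _ (fun n x => (tilt (phi_ (n + N)%N) (w1 + harmonic (n + N)%N) x
     - tilt (psi_ (n + N)%N) (w2 + harmonic (n + N)%N) x) ^+ 2) _
   (fun n => (w1 + harmonic (n + N)%N) + (w2 + harmonic (n + N)%N) - 2 * (wm - e / 2))).
- by move=> n; apply: measurable_funX; apply: measurable_funB; exact: measurable_tilt.
- by apply: measurable_funX; apply: measurable_funB; exact: measurable_tilt.
- by move=> n x; exact: sqr_ge0.
- by move=> x; exact: sqr_ge0.
- have tcvg (u_ : nat -> L0 mu) (u : L0 mu) w x : (fun n => u_ n x) @ \oo --> u x ->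
      (fun n => tilt (u_ (n + N)%N) (w + harmonic (n + N)%N) x) @ \oo --> tilt u w x.
    move=> ux; rewrite (cvg_shiftn N (fun n => tilt (u_ n) (w + harmonic n) x)).
    apply: continuous_cvg; first exact: continuous_expR.
    apply: cvgM; last exact: cvg_cst.
    apply: cvgB => //; rewrite -[X in _ --> X]addr0.
    by apply: cvgD; [exact: cvg_cst|exact: cvg_harmonic].
  near=> x; under eq_fun do rewrite expr2; rewrite expr2.
  by apply: cvgM; apply: cvgB; apply: tcvg; near: x.
- move=> n; apply: int_tilt_sqrB => //.
  by apply: ltW; apply: hr; [exact: Kmu_mid|apply: NV => /=; exact: leq_addl].
- rewrite (cvg_shiftn N (fun n => w1 + harmonic n + (w2 + harmonic n) - 2 * (wm - e / 2))).
  rewrite (_ : _ + e = (w1 + 0 + (w2 + 0) - 2 * (wm - e / 2))); last by field.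
  apply: cvgB; last exact: cvg_cst.
  by apply: cvgD; apply: cvgD; (exact: cvg_cst || exact: cvg_harmonic).
Unshelve. all: by end_near. Qed.

(** By the midpoint estimate the tilts [exp ((U n - w n) / 2)] have summable
    L2-distances, hence converge almost everywhere. Their limit does not vanish,
    as the negative parts of the [U n] are bounded in L1, so taking logarithms
    is legitimate. *)
Lemma Wmu_fast_cvg (U : nat -> Lmu mu) (w : nat -> R) (w0 C : R) :
  (forall n, (Wmu mu (U n) <= (w n)%:E)%E) -> w @ \oo --> w0 ->
  (forall n, w n <= C) ->
  (forall n, ((w n.+1 + w n - (2 ^- n.+1) ^+ 2) / 2)%:E <=
     Wmu mu (2^-1 *: (U n.+1 + U n)))%E ->
  exists2 S : Lmu mu, {ae mu, forall x, (fun n => L0_fun (U n) x) @ \oo --> S x} &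
    (Wmu mu S <= w0%:E)%E.
Proof.
move=> WU ww0 wC gap.
have WC n : (Wmu mu (U n) <= C%:E)%E by apply: le_trans (WU n) _; rewrite lee_fin.
have mt := measurable_tilt.
pose r n x := tilt (U n) (w n) x.
have mr n : measurable_fun setT (r n) by exact: mt.
have r_cvg : {ae mu, forall x, cvgn (r ^~ x)}.
  apply: ae_cvg_summable => //.
  apply: (@le_lt_trans _ _ (\sum_(n <oo) (1 / (2 ^ n.+1)%:R)%:E)%E); last first.
    by apply: le_lt_trans (@epsilon_trick0 R 1 xpredT ler01) _; rewrite ltry.
  apply: lee_nneseries => [n *|n _].
    by apply: integral_ge0 => x _; rewrite lee_fin.
  (* [a <= q / 2 * a^2 + q^-1 / 2] turns the L2-bound [q^-1] into an L1-bound *)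
  rewrite natrX div1r; set q := 2 ^+ n.+1.
  have q0 : 0 < q by rewrite exprn_gt0.
  have := Wmu_midpoint_gap (WU n.+1) (WU n) (gap n).
  rewrite (_ : _ - _ = q^-1 ^+ 2); last by rewrite /q; field.
  move=> gapn.
  apply: (@le_trans _ _ (\int[mu]_x (((q / 2)%:E * ((r n.+1 x - r n x) ^+ 2)%:E)
      + (q^-1 / 2)%:E))%E).
    apply: ge0_le_integral => //.
    - by apply/measurable_EFinP; apply: measurableT_comp => //; exact: measurable_funB.
    - apply: emeasurable_funD => //; apply: measurable_funeM.
      by apply/measurable_EFinP; apply: measurable_funX; exact: measurable_funB.
    - move=> x _; rewrite -EFinM -EFinD lee_fin.
      rewrite -real_normK ?num_real//; set a := `|_|.
      have : 0 <= q / 2 * (a - q^-1) ^+ 2 by rewrite mulr_ge0 ?sqr_ge0// divr_ge0// ltW.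
      rewrite (_ : q / 2 * _ = q / 2 * a ^+ 2 + q^-1 / 2 - a).
        by rewrite subr_ge0.
      by field; rewrite gt_eqF.
  rewrite ge0_integralD//; first last.
  - by move=> x _; rewrite lee_fin divr_ge0// invr_ge0 ltW.
  - apply: measurable_funeM; apply/measurable_EFinP; apply: measurable_funX.
    exact: measurable_funB.
  - by move=> x _; rewrite mule_ge0// lee_fin ?sqr_ge0// divr_ge0// ltW.
  rewrite integral_cst// [X in (_ + _ * X)%E]probability_setT mule1.
  rewrite ge0_integralZl_EFin//; first last.
  - by rewrite divr_ge0// ltW.
  - apply/measurable_EFinP; apply: measurable_funX; exact: measurable_funB.
  - by move=> x _; rewrite lee_fin sqr_ge0.
  apply: (@le_trans _ _ ((q / 2)%:E * (q^-1 ^+ 2)%:E + (q^-1 / 2)%:E)%E).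
    by rewrite leeD2r// lee_pmul2l// lte_fin divr_gt0.
  by rewrite -EFinM -EFinD lee_fin le_eqVlt; apply/orP; left; apply/eqP; field; rewrite gt_eqF.
have mneg n : measurable_fun setT (fun x => Num.max (- U n x) 0).
  apply: measurable_maxr => //.
  by apply: measurableT_comp => //; exact: L0_measurable.
have neg_fin : {ae mu, forall x, ~ ((fun n => (Num.max (- U n x) 0)%:E) @ \oo --> +oo%E)}.
  apply: (@ae_not_cvgy _ _ _ mu _ (expR C)) => // [n x|n].
    by rewrite le_max lexx orbT.
  exact: Wmu_neg.
have U_cvg : {ae mu, forall x, cvgn (fun n => L0_fun (U n) x)}.
  near=> x.
  have /cvg_ex[l rl] : cvgn (r ^~ x) by near: x.
  have r0 n : 0 < r n x by exact: expR_gt0.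
  have UE n : L0_fun (U n) x = 2 * ln (r n x) + w n.
    by rewrite /r /tilt expRK; field.
  have l0 : 0 <= l.
    by apply: (cvgr_to_ge rl); apply: nearW => n; exact: ltW.
  move: l0; rewrite le_eqVlt => /orP[/eqP l0|l0].
    (* a vanishing tilt means [U n x -> -oo], as [w] is bounded above *)
    exfalso.
    have : ~ ((fun n => (Num.max (- U n x) 0)%:E) @ \oo --> +oo%E) by near: x.
    apply; apply/cvgeryP/cvgryPge => A.
    pose e := expR ((- A - C) / 2).
    have e0 : 0 < e by exact: expR_gt0.
    have re : \forall n \near \oo, r n x < e by apply: (cvgr_lt l) => //; rewrite -l0.
    near=> n.
    rewrite le_max; apply/orP; left; rewrite UE.
    have re' : r n x < e by near: n.
    have : ln (r n x) < (- A - C) / 2 by rewrite -[ltRHS]expRK ltr_ln ?posrE.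
    by have := wC n; lra.
  apply/cvg_ex; exists (2 * ln l + w0); under eq_fun do rewrite UE.
  apply: cvgD => //; apply: cvgM; first exact: cvg_cst.
  by apply: continuous_cvg => //; exact: continuous_ln.
pose f x := fine (limn_esup (fun n => (L0_fun (U n) x)%:E)).
have mf : measurable_fun setT f.
  apply: measurableT_comp => //; apply: measurable_fun_limn_esup => n.
  by apply/measurable_EFinP; exact: L0_measurable.
have Uf : {ae mu, forall x, (fun n => L0_fun (U n) x) @ \oo --> f x}.
  apply: filterS U_cvg => x /cvg_ex[l Ul].
  have /cvg_limn_einf_sup[_ lE] : (fun n => (L0_fun (U n) x)%:E) @ \oo --> l%:E.
    by exact: cvg_comp Ul _.
  by rewrite /f lE.
have Uc : {ae mu, forall x, (fun n => L0_fun (U n) x) @ \oo --> cls mu mf x}.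
  near=> x.
  have -> // := near (clsE mu mf) x.
  by near: x.
have [S SE WS] := Lmu_limit Uc WU ww0.
by exists S => //; rewrite SE.
Unshelve. all: by end_near. Qed.

End Wmu_theory.

(** * Dual cones of asymmetric norms *)

Section scalar_form.
Context {R : realType} {E : lmodType R} (z : E -> R).
Hypothesis zs : scalar z.

Lemma scalar_D u v : z (u + v) = z u + z v.
Proof. by have := zs 1 u v; rewrite scale1r mul1r. Qed.

Lemma scalar_0 : z 0 = 0.
Proof. by apply: (addrI (z 0)); rewrite -scalar_D !addr0. Qed.

Lemma scalar_Z a u : z (a *: u) = a * z u.
Proof. by have := zs a u 0; rewrite !addr0 scalar_0 addr0. Qed.

Lemma scalar_N u : z (- u) = - z u.
Proof. by rewrite -scaleN1r scalar_Z mulN1r. Qed.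

Lemma scalar_B u v : z (u - v) = z u - z v.
Proof. by rewrite scalar_D scalar_N. Qed.
End scalar_form.

Section dual_cone.
Context {R : realType} {E : lmodType R} (q : E -> R).
Hypothesis q0 : forall T, 0 <= q T.

Lemma dual_cone_comb (a b : R) z1 z2 : 0 <= a -> 0 <= b ->
  dual_cone q z1 -> dual_cone q z2 -> dual_cone q (a \*o z1 \+ b \*o z2).
Proof.
move=> a0 b0 [s1 [C1 C10 h1]] [s2 [C2 C20 h2]]; split.
  by move=> c u v /=; rewrite s1 s2; ring.
exists (a * C1 + b * C2); first by rewrite addr_ge0// mulr_ge0.
move=> T /=; rewrite mulrDl -!mulrA lerD// ler_wpM2l//.
Qed.

Lemma sym_dual_norm_le z C : scalar z -> 0 <= C -> (forall T, z T <= C * q T) ->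
  (sym_dual_norm q z <= C%:E)%E.
Proof.
move=> sz C0 zC; apply: ge_ereal_sup => _ [T /= T1 <-]; rewrite lee_fin.
have [qT qNT] : q T <= 1 /\ q (- T) <= 1 by apply/andP; rewrite -ge_max.
rewrite ler_norml lerNl -(scalar_N sz).
by apply/andP; split; apply: le_trans (zC _) _; rewrite -[leRHS]mulr1 ler_wpM2l.
Qed.

(** The norm is a supremum over the open ball only, hence the [+ 1]: the vector
    [T / (q T + 1)] lies in that ball even when [q T = 0]. *)
Lemma dual_cone_norm_le z (r : R) T : (forall a S, 0 <= a -> q (a *: S) = a * q S) ->
  scalar z -> (dual_cone_norm q z < r%:E)%E -> z T <= r * (q T + 1).
Proof.
move=> qZ sz zr; have c0 : 0 < q T + 1 by rewrite ltr_wpDl.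
have : ((z ((q T + 1)^-1 *: T))%:E <= r%:E)%E.
  apply: le_trans (ltW zr); apply: ereal_sup_ubound; exists ((q T + 1)^-1 *: T) => //=.
  by rewrite qZ ?invr_ge0 ?ltW// mulrC ltr_pdivrMr// mul1r ltrDl.
by rewrite lee_fin (scalar_Z sz) mulrC ler_pdivrMr.
Qed.

Lemma dual_cone_eval_continuous v T : (forall a S, 0 <= a -> q (a *: S) = a * q S) ->
  z T @[z --> dual_cone_nbhs q v] --> v T.
Proof.
move=> qZ B /nbhs_ballP[e /= e0 eB].
pose K := q T + q (- T) + 2.
have K0 : 0 < K by rewrite ltr_wpDl// addr_ge0.
exists (e / K); first by rewrite /= divr_gt0.
move=> _ [z [[sz _] zn] <-]; apply: eB; rewrite /ball/= opprD addNKr normrN.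
have h T' : q T' + 1 < K -> z T' < e.
  move=> TK; apply: le_lt_trans (dual_cone_norm_le _ qZ sz zn) _.
  by rewrite mulrAC ltr_pdivrMr// ltr_pM2l.
have qT := q0 T; have qNT := q0 (- T).
rewrite ltr_norml ltrNl -(scalar_N sz) !h//; rewrite /K; lra.
Qed.
End dual_cone.

(** * Minimisers *)

Section minimisers.
Context {R : realType} {X : tvsType R} (mu : probability (borel X) R).
Hypothesis mu_integrable : forall phi : {linear X -> R^o}, continuous phi ->
  mu.-integrable [set: borel X] (fun x => (phi x)%:E).
Hypothesis mu_centred : forall phi : {linear X -> R^o}, continuous phi ->
  (\int[mu]_x (phi x)%:E = 0)%E.
Variable y : Lmu mu -> R.
Hypothesis Y_y : dual_cone (pbarmu mu) y.

Local Notation W := (Wmu mu).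
Local Notation Y := (dual_cone (pbarmu mu)).

(** Test the bound with [z = e y + (1 + e) t v]. With [Q = y S + t (v S)] it reads
    [(1 + e) Q - M <= W S], and a bound [W S <= B + Q] then forces
    [Q <= (M + B) / e]. *)
Lemma coercive (eps M : R) : 0 < eps ->
  (forall z, Y z -> (sym_dual_norm (pbarmu mu) z < eps%:E)%E ->
    forall S, ((y S + z S - M)%:E <= W S)%E) ->
  forall v, Y v -> exists2 t0, 0 < t0 & forall B, exists C, forall t S,
    0 <= t <= t0 -> (W S <= (B + y S + t * v S)%:E)%E -> (W S <= C%:E)%E.
Proof.
move=> eps0 hM v Yv.
have [sy [Cy Cy0 yC]] := Y_y; have [sv [Cv Cv0 vC]] := Yv.
pose t0 := eps / (4 * (Cv + 1)).
have Cv1 : 0 < 4 * (Cv + 1) by rewrite mulr_gt0// ltr_wpDl.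
have Cy1 : 0 < 2 * (Cy + 1) by rewrite mulr_gt0// ltr_wpDl.
have t00 : 0 < t0 by rewrite divr_gt0.
pose e := Num.min 1 (eps / (2 * (Cy + 1))).
have e0 : 0 < e by rewrite lt_min ltr01 divr_gt0.
have e1 : e <= 1 by rewrite ge_min lexx.
have eCy : e * Cy < eps / 2.
  have : e <= eps / (2 * (Cy + 1)) by rewrite ge_min lexx orbT.
  rewrite ler_pdivlMr// => h; have : 0 < e * 2 by rewrite mulr_gt0.
  by lra.
exists t0 => // B; exists (B + (M + B) / e) => t S /andP[t_0 tt0] WS.
have tCv : (1 + e) * t * Cv < eps / 2.
  move: tt0; rewrite ler_pdivlMr// => tt0.
  have : (1 + e) * (t * Cv) <= 2 * (t * Cv).
    by rewrite ler_wpM2r ?mulr_ge0//; lra.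
  rewrite -mulrA => h; apply: le_lt_trans h _.
  have [t_eq0|tn0] := eqVneq t 0; first by rewrite t_eq0 mul0r mulr0 divr_gt0.
  have : 0 < t by rewrite lt_neqAle eq_sym tn0.
  by lra.
pose z := (e \*o y \+ ((1 + e) * t) \*o v).
have e10 : 0 <= (1 + e) * t by rewrite mulr_ge0// addr_ge0// ltW.
have Yz : Y z by apply: dual_cone_comb => //; exact: ltW.
have zn : (sym_dual_norm (pbarmu mu) z < eps%:E)%E.
  apply: (@le_lt_trans _ _ (e * Cy + (1 + e) * t * Cv)%:E).
    apply: sym_dual_norm_le; first by case: Yz.
      by rewrite addr_ge0// mulr_ge0// ltW.
    move=> T; rewrite /z/= [leRHS]mulrDl.
    by apply: lerD; rewrite -[leRHS]mulrA ler_wpM2l// ltW.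
  by rewrite lte_fin [ltRHS]splitr ltrD.
have := le_trans (hM z Yz zn S) WS; rewrite lee_fin /z/= => h.
apply: le_trans WS _; rewrite lee_fin -addrA lerD2l ler_pdivlMr//.
by move: h; lra.
Qed.

Variable m : R.
Hypothesis mW : forall S, ((m + y S)%:E <= W S)%E.
Hypothesis m_inf : forall e, 0 < e -> exists S, (W S <= (m + y S + e)%:E)%E.
Hypothesis coer : forall B, exists C, forall S, (W S <= (B + y S)%:E)%E -> (W S <= C%:E)%E.

(** The values [W (U n)] are bounded; select indices [k j >= j] along which they
    converge to a cluster point. The rate of minimality is chosen such that the
    midpoint defects satisfy the hypothesis of [Wmu_fast_cvg]. Minimality of the
    limit uses that [y] is upper semicontinuous along the selected sequence. *)
Lemma compact_minimising (U : nat -> Lmu mu) :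
  (forall n, W (U n) <= (m + y (U n) + (2 ^- n.+1) ^+ 2 / 2)%:E)%E ->
  exists2 S, (W S <= (m + y S)%:E)%E &
    forall z d N, Y z -> 0 < d -> exists2 n, (N <= n)%N & z (U n - S) < d.
Proof.
move=> WU.
pose eps n : R := (2 ^- n.+1) ^+ 2 / 2.
have eps0 n : 0 < eps n.
  by rewrite divr_gt0// exprn_gt0// invr_gt0 exprn_gt0.
have epsD : {homo eps : n k / (n <= k)%N >-> k <= n}.
  move=> n k nk; rewrite ler_pM2r ?invr_gt0//.
  rewrite ler_pXn2r// ?nnegrE ?invr_ge0 ?exprn_ge0//.
  by rewrite lef_pV2 ?posrE ?exprn_gt0// ler_eXn2l ?ltr1n.
have eps1 n : eps n <= 1.
  apply: le_trans (epsD 0%N n (leq0n n)) _; rewrite /eps expr1.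
  by lra.
have [C hC] := coer (m + 1).
have WC n : (W (U n) <= C%:E)%E.
  apply: hC; apply: le_trans (WU n) _; rewrite lee_fin.
  by have := eps1 n; rewrite /eps; lra.
pose w n := fine (W (U n)).
have wE n : W (U n) = (w n)%:E.
  rewrite fineK// ge0_fin_numE ?Wmu_ge0//.
  by apply: le_lt_trans (WC n) _; rewrite ltry.
have wC n : w n <= C by rewrite -lee_fin -wE.
have w0 n : 0 <= w n by rewrite -lee_fin -wE Wmu_ge0.
have [l hl] : exists l, forall j, exists k, (j <= k)%N /\ `|w k - l| < harmonic j.
  have [|l [_ cl]] := @segment_compact R 0 C (w @ \oo) (fmap_proper_filter _ _).
    by exists 0%N => // n _ /=; rewrite in_itv/= w0 wC.
  exists l => j.
  have [_ /= [[k /= jk <-] kl]] := cl (w @` [set k | (j <= k)%N]) (ball l (harmonic j))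
    (ex_intro2 _ _ j I (fun k jk => ex_intro2 _ _ k jk erefl))
    (nbhsx_ballx _ _ (harmonic_gt0 j)).
  by exists k; split => //; rewrite distrC.
have [k hk] := choice hl.
have jk j : (j <= k j)%N by have [] := hk j.
have wk : (fun j => w (k j)) @ \oo --> l.
  apply/cvgrPdist_lt => e e0; near=> j; rewrite distrC.
  have [_ /lt_trans] := hk j; apply.
  by near: j; exact: (near_infty_natSinv_lt (PosNum e0)).
have wy n : w n <= m + y (U n) + eps n by rewrite -lee_fin -wE WU.
have [sy _] := Y_y.
have [S US WS] : exists2 S : Lmu mu,
    {ae mu, forall x, (fun n => L0_fun (U (k n)) x) @ \oo --> S x} & (W S <= l%:E)%E.
  apply: (@Wmu_fast_cvg _ _ mu mu_integrable mu_centred (U \o k) (w \o k) l C) => //.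
  - by move=> n; rewrite /= wE.
  - by move=> n; exact: wC.
  move=> n; apply: le_trans (mW _); rewrite lee_fin (scalar_Z sy) (scalar_D sy) /=.
  have := wy (k n.+1); have := wy (k n).
  have := epsD _ _ (jk n); have := epsD _ _ (leq_trans (leqnSn n) (jk n.+1)).
  by rewrite {2 4}/eps; lra.
have Uz z d : Y z -> 0 < d -> \forall n \near \oo, z (U (k n) - S) < d.
  move=> [sz [Cz Cz0 zC]] d0.
  have e0 : 0 < d / (Cz + 1) by rewrite divr_gt0// ltr_wpDl.
  have := pbarmu_sub_cvg US (fun n => WC (k n)) e0.
  apply: filterS => n pn; apply: le_lt_trans (zC _) _.
  apply: (@le_lt_trans _ _ (Cz * (d / (Cz + 1)))); first by rewrite ler_wpM2l.
  by rewrite mulrA ltr_pdivrMr ?ltr_wpDl// mulrC ltr_pM2l// ltrDl.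
exists S; last first.
  move=> z d N Yz d0.
  have [n [zn /= Nn]] := filter_ex (filterI (Uz z d Yz d0) (nbhs_infty_ge N)).
  by exists (k n) => //; exact: leq_trans Nn (jk n).
apply: le_trans WS _; rewrite lee_fin; apply/ler_addgt0Pr => e e0.
have e30 : 0 < e / 3 by rewrite divr_gt0.
have neps : \forall n \near \oo, eps (k n) < e / 3.
  near=> n; apply: le_lt_trans (epsD _ _ (jk n)) _.
  apply: (@le_lt_trans _ _ (1 / 2 ^+ n)); last first.
    by near: n; exact: (near_infty_natSinv_expn_lt (PosNum e30)).
  rewrite /eps div1r.
  have q1 : (2 ^- n.+1 : R) <= 2 ^- n.
    by rewrite lef_pV2 ?posrE ?exprn_gt0// ler_eXn2l ?ltr1n.
  have q2 : (2 ^- n.+1 : R) <= 1 by rewrite invf_le1 ?exprn_gt0// exprn_ege1 ?ler1n.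
  have q0 : (0 : R) < 2 ^- n.+1 by rewrite invr_gt0 exprn_gt0.
  by nra.
near \oo => n.
have h1 : y (U (k n) - S) < e / 3 by near: n; exact: Uz.
have h2 : eps (k n) < e / 3 by near: n.
have h3 : l - e / 3 < w (k n) by near: n; apply: (cvgr_gt l) => //; rewrite ltrBlDr ltrDl.
move: h1; rewrite (scalar_B sy); have := wy (k n); lra.
Unshelve. all: by end_near. Qed.

(** The midpoint defect of two minimisers is nonpositive, so that
    [S - W S = T - W T] almost everywhere and [S <= T] when [y S <= y T]. *)
Lemma minimisers_compare (S T : Lmu mu) : (W S <= (m + y S)%:E)%E ->
  (W T <= (m + y T)%:E)%E -> y S <= y T -> pbarmu mu (S - T) = 0.
Proof.
move=> WS WT yST; have [sy _] := Y_y.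
have := @Wmu_midpoint_gap _ _ mu S T _ _ (m + (y S + y T) / 2) WS WT.
rewrite [X in (X <= _)%E -> _](_ : _ = (m + y (2^-1 *: (S + T)))%:E); last first.
  by rewrite (scalar_Z sy) (scalar_D sy) mulrC.
move=> /(_ (mW _)); rewrite (_ : _ - _ = 0); last by field.
set G := (fun x => _) => G0.
have {}G0 : (\int[mu]_x G x = 0)%E.
  apply/eqP; rewrite eq_le G0 integral_ge0// => x _.
  by rewrite lee_fin sqr_ge0.
have mG : measurable_fun setT G.
  by apply/measurable_EFinP; apply: measurable_funX; apply: measurable_funB;
    exact: measurable_tilt.
have : ae_eq mu setT G (cst 0%E).
  apply/(ae_eq_integral_abs mu measurableT mG).
  rewrite -[RHS]G0; apply: eq_integral => x _.
  by rewrite gee0_abs// lee_fin sqr_ge0.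
move=> aeG.
apply/eqP; rewrite -eqe pbarmuE; apply/eqP.
apply: etrans (integral0 mu setT); apply: ge0_ae_eq_integral => //.
- by apply/measurable_EFinP/measurable_maxr => //; exact: L0_measurable.
- by move=> x _; rewrite lee_fin le_max lexx orbT.
near=> x => _.
have Gx : G x = 0%E by have := near aeG x; apply.
rewrite /= -[RHS]/(0%:E); congr _%:E; apply/max_idPr.
have -> // := near (L0D (Lval S) (- Lval T)) x.
rewrite /=.
have -> // := near (L0N (Lval T)) x.
move: Gx => [/eqP]; rewrite sqrf_eq0 subr_eq0 /tilt => /eqP/expR_inj.
by move=> /=; lra.
Unshelve. all: by end_near. Qed.

(** [T] maximises [y] among the minimisers. If near-minimality did not give
    [z (S - T) < d], a sequence of counterexamples would cluster at a minimiser
    below [T], where [z] is at most its value at [T]. *)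
Lemma max_minimiser : exists2 T, (W T <= (m + y T)%:E)%E &
  forall z d, Y z -> 0 < d -> exists2 e, 0 < e &
    forall S, (W S <= (m + y S + e)%:E)%E -> z (S - T) < d.
Proof.
pose eps n : R := (2 ^- n.+1) ^+ 2 / 2.
have eps0 n : 0 < eps n.
  by rewrite divr_gt0// exprn_gt0// invr_gt0 exprn_gt0.
pose A := [set y S | S in [set S | (W S <= (m + y S)%:E)%E]].
have [C hC] := coer m.
have A_sup : has_sup A.
  split.
    have [U hU] := choice (fun n => m_inf (eps0 n)).
    by have [S WS _] := compact_minimising hU; exists (y S), S.
  exists (C - m) => _ [S /= WS <-].
  have := le_trans (mW S) (hC S WS); rewrite lee_fin; lra.
have ex n : exists S, (W S <= (m + y S)%:E)%E /\ sup A - harmonic n < y S.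
  have [_ [S WS <-] h] := sup_adherent (harmonic_gt0 n) A_sup.
  by exists S.
have [U hU] := choice ex.
have [sy _] := Y_y.
have [T WT UT] : exists2 S, (W S <= (m + y S)%:E)%E &
    forall z d N, Y z -> 0 < d -> exists2 n, (N <= n)%N & z (U n - S) < d.
  apply: compact_minimising => n; have [WU _] := hU n; apply: le_trans WU _.
  by rewrite lee_fin lerDl; exact/ltW/eps0.
have yT : sup A <= y T.
  apply/ler_addgt0Pr => e e0.
  have e20 : 0 < e / 2 by rewrite divr_gt0.
  have [N _ hN] := near_infty_natSinv_lt (PosNum e20).
  have [n Nn] := UT y (e / 2) N Y_y e20; rewrite (scalar_B sy).
  have [_] := hU n; have h : harmonic n < e / 2 by exact: hN n Nn.
  by move: h; lra.
exists T => // z d Yz d0; apply: contrapT => h.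
have ex2 n : exists S, (W S <= (m + y S + eps n)%:E)%E /\ d <= z (S - T).
  apply: contrapT => h2; apply: h; exists (eps n) => // S WS.
  by rewrite ltNge; apply/negP => dz; apply: h2; exists S.
have [V hV] := choice ex2.
have [S WS VS] := compact_minimising (fun n => (hV n).1).
have [n _] := VS z d 0%N Yz d0.
have [sz [Cz Cz0 zC]] := Yz.
have : z (S - T) <= 0.
  apply: le_trans (zC _) _; rewrite minimisers_compare ?mulr0//.
  by apply: le_trans yT; apply: ub_le_sup; [exact: A_sup.2|exists S].
have := (hV n).2; rewrite !(scalar_B sz); lra.
Qed.

End minimisers.

Theorem mainTheorem4 (R : realType) (X : tvsType R)
    (mu : probability (borel X) R)
    (mu_integrable : forall phi : {linear X -> R^o}, continuous phi ->
      mu.-integrable [set: borel X] (fun x => (phi x)%:E))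
    (mu_centred : forall phi : {linear X -> R^o}, continuous phi ->
      (\int[mu]_x (phi x)%:E = 0)%E)
    (y : Lmu mu -> R)
    (Y_y : dual_cone (pbarmu mu) y)
    (dom_y : (conjugate (Wmu mu) y < +oo)%E)
    (bounded_near_y : exists2 eps : R, 0 < eps &
      (ereal_sup [set conjugate (Wmu mu) (y \+ z)%R | z in
         [set z | dual_cone (pbarmu mu) z /\
                  (sym_dual_norm (pbarmu mu) z < eps%:E)%E]] < +oo)%E) :
  exists T : Lmu mu,
    [/\ (Wmu mu T - (y T)%:E)%E =
          ereal_inf [set (Wmu mu S - (y S)%:E)%E | S in [set: Lmu mu]],
        forall Tn : nat -> Lmu mu,
          minimising (fun S : Lmu mu => (Wmu mu S - (y S)%:E)%E) Tn ->
          weak_cvg (pbarmu mu) Tn T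
      & is_right_gateaux (pbarmu mu) (conjugate (Wmu mu)) y
          (fun z => z T)].
Proof.
have conj_ub z S : ((z S)%:E - Wmu mu S <= conjugate (Wmu mu) z)%E.
  by apply: ereal_sup_ubound; exists S.
have [eps eps0 sup_fin] := bounded_near_y.
have [M hM] : exists M, forall z, dual_cone (pbarmu mu) z ->
    (sym_dual_norm (pbarmu mu) z < eps%:E)%E ->
    forall S, ((y S + z S - M)%:E <= Wmu mu S)%E.
  have [M hM] : exists M : R, (ereal_sup [set conjugate (Wmu mu) (y \+ z)%R | z in
         [set z | dual_cone (pbarmu mu) z /\
                  (sym_dual_norm (pbarmu mu) z < eps%:E)%E]] <= M%:E)%E.
    move: sup_fin; case: ereal_sup => [r _|//|_]; first by exists r.
    by exists 0; rewrite leNye.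
  exists M => z Yz zn S; rewrite -lee_subl_real.
  apply: le_trans (conj_ub (y \+ z) S) _; apply: le_trans hM.
  by apply: ereal_sup_ubound; exists z.
have [sy [Cy Cy0 yC]] := Y_y.
have conj_fin : conjugate (Wmu mu) y \is a fin_num.
  rewrite ge0_fin_numE//; apply: le_trans (conj_ub y 0).
  by rewrite (scalar_0 sy) sub0e oppe_ge0 Wmu0_le0.
have [m conjE] : exists m, conjugate (Wmu mu) y = (- m)%:E.
  by exists (- fine (conjugate (Wmu mu) y)); rewrite opprK fineK.
have mW S : ((m + y S)%:E <= Wmu mu S)%E.
  by rewrite -[m]opprK addrC -lee_subl_real -conjE.
have m_inf e : 0 < e -> exists S, (Wmu mu S <= (m + y S + e)%:E)%E.
  move=> e0; have [_ [S _ <-]] := ub_ereal_sup_adherent e0 conj_fin.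
  rewrite -/(conjugate _ _) conjE -EFinB => h; exists S.
  move: h; rewrite ltNge lee_subl_real -ltNge => /ltW; congr (_ <= _%:E)%E; ring.
have coer := coercive Y_y eps0 hM.
have coer0 B : exists C, forall S,
    (Wmu mu S <= (B + y S)%:E)%E -> (Wmu mu S <= C%:E)%E.
  have [t0 t00 ht] := coer _ Y_y; have [C hC] := ht B; exists C => S WS.
  by apply: (hC 0); [rewrite lexx ltW|rewrite mul0r addr0].
have [T WT Tmax] := max_minimiser mu_integrable mu_centred Y_y mW m_inf coer0.
have WTE : Wmu mu T = (m + y T)%:E by apply/eqP; rewrite eq_le WT mW.
have infE : ereal_inf [set (Wmu mu S - (y S)%:E)%E | S in [set: Lmu mu]] = m%:E.
  apply/eqP; rewrite eq_le; apply/andP; split.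
    by apply: ereal_inf_lbound; exists T => //; rewrite WTE -EFinB addrK.
  apply: le_ereal_inf_tmp => _ [S _ <-]; rewrite leeBrDr// -EFinD; exact: mW.
exists T; split.
- by rewrite infE WTE -EFinB addrK.
- move=> Tn minTn z Yz; apply: limn_esup_le0 => d d0.
  have [e e0 he] := Tmax z d Yz d0.
  have : \forall n \near \oo, (Wmu mu (Tn n) - (y (Tn n))%:E < (m + e)%:E)%E.
    apply: (minTn [set w | (w < (m + e)%:E)%E]).
    by rewrite infE; apply: open_ereal_lt'; rewrite lte_fin ltrDl.
  apply: filterS => n /ltW; rewrite leeBlDr// -EFinD => h; apply: he.
  by apply: le_trans h _; rewrite lee_fin addrAC.
split => //.
  move=> v Yv; apply: dual_cone_eval_continuous; first exact: pbarmu_ge0.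
  exact: pbarmuZ.
move=> v Yv.
have gat d : 0 < d -> \forall t \near 0^'+, exists2 r : R, 0 <= r <= d &
   (t^-1%:E * (conjugate (Wmu mu) (y \+ t \*o v)%R - conjugate (Wmu mu) y -
      (t * v T)%:E))%E = r%:E.
  move=> d0; have [e e0 he] := Tmax v d Yv d0.
  have [t0 t00 ht] := coer _ Yv.
  have [C hC] := ht (m + t0 * `|v T|).
  have [sv [Cv Cv0 vC]] := Yv.
  pose K := Cv * expR C + `|v T| + 1.
  have K0 : 0 < K by rewrite ltr_wpDl// addr_ge0// mulr_ge0// expR_ge0.
  have eK0 : 0 < e / K by rewrite divr_gt0.
  near=> t.
  have t_gt0 : 0 < t by near: t; exact: nbhs_right_gt.
  have t_t0 : t <= t0 by near: t; exact: nbhs_right_le.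
  have t_eK : t <= e / K by near: t; exact: nbhs_right_le.
  have lb : ((- m + t * v T)%:E <= conjugate (Wmu mu) (y \+ t \*o v)%R)%E.
    apply: le_trans (conj_ub _ T); rewrite WTE -EFinB lee_fin /=; clear; lra.
  (* Any [S] violating the upper bound is nearly minimal for [W - y], and then
     [v (S - T) < d] contradicts the minimality of [m]. *)
  have ub : (conjugate (Wmu mu) (y \+ t \*o v)%R <= (- m + t * v T + t * d)%:E)%E.
    apply: ge_ereal_sup => _ [S _ <-]; rewrite leNgt; apply/negP.
    rewrite ltNge lee_subl_real -ltNge => /ltW /= WS.
    have vTn := ler_norm (v T); have vTn' := ler_norm (- v T).
    rewrite normrN in vTn'.
    have WC : (Wmu mu S <= C%:E)%E.
      apply: (hC t); first by rewrite ltW.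
      apply: le_trans WS _; rewrite lee_fin.
      have h1 : t * - v T <= t0 * `|v T|.
        apply: (@le_trans _ _ (t * `|v T|)); first by rewrite ler_pM2l.
        by rewrite ler_wpM2r.
      have h2 : 0 <= t * d by rewrite mulr_ge0// ltW.
      by clear - h1 h2; lra.
    have vS : v S <= Cv * expR C.
      by apply: le_trans (vC S) _; rewrite ler_wpM2l// Wmu_pbar.
    have Se : (Wmu mu S <= (m + y S + e)%:E)%E.
      apply: le_trans WS _; rewrite lee_fin.
      have h1 : t * K <= e by rewrite -ler_pdivlMr.
      have h2 : t * (v S - v T - d) <= t * K.
        by rewrite ler_pM2l// /K; clear - vS vTn' d0; lra.
      by clear - h1 h2; lra.
    have := he S Se; rewrite (scalar_B sv) => vST.
    have := le_trans (mW S) WS; rewrite lee_fin.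
    have : 0 < t * (d - (v S - v T)) by rewrite mulr_gt0// subr_gt0.
    by clear; lra.
  have fc : conjugate (Wmu mu) (y \+ t \*o v)%R \is a fin_num.
    rewrite fin_numE; apply/andP; split; apply/eqP => E.
      by move: lb; rewrite E.
    by move: ub; rewrite E.
  move: lb ub; rewrite -(fineK fc) !lee_fin; set r := fine _ => lb ub.
  exists (t^-1 * (r + m - t * v T)); last by rewrite conjE -!EFinB -EFinM opprK.
  rewrite mulrC divr_ge0 ?(ltW t_gt0)//=; last by clear - lb; lra.
  by rewrite ler_pdivrMr//; clear - ub; lra.
apply/fine_cvgP; split.
  by apply: filterS (gat 1 ltr01) => t [r _ ->].
apply/cvgrPdist_le => d d0; apply: filterS (gat d d0) => t [r /andP[r0 rd] /= ->].
by rewrite /= sub0r normrN ger0_norm.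
Unshelve. all: by end_near. Qed.
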